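(* Let $\gamma\in\mathcal{S}(S_{0,4})$ be a (cyclically reduced) simple word, with continued fraction expansion of its slope of length $r(\gamma)$ and special lengths $l_i(\gamma)$. Fix $10\le i\le r(\gamma)$ such that $|\gamma|\ge 10\,l_i(\gamma)$. Let $w\in\mathbb{F}_3$ be any subword of $\gamma$ of length $l_i(\gamma)-5$. Then the word $\gamma$ can be decomposed as a concatenation $\gamma=u_1\cdots u_q$ such that there exists a subset $\mathcal{I}\subset\{1,\dots,q\}$ satisfying: (1) for all $k\in\mathcal{I}$, $u_k\in\{w,w^{-1}\}$; (2) $\displaystyle\sum_{k\in\mathcal{I}}|u_k|\ge\frac1{30}|\gamma|$.
   Context: The four-punctured sphere $S_{0,4}$ is identified with $(\mathbb{R}^2\setminus\mathbb{Z}^2)/\Gamma$, where $\Gamma$ is the group generated by the translations by $2\mathbb{Z}^2$ and $x\mapsto -x$. Its fundamental group is $\mathbb{F}_3=\langle a,b,c\rangle$, where $a,b,c$ are loops around the punctures corresponding to the classes of $(1,0),(0,1),(1,1)$ modulo $2\mathbb{Z}^2$, and $abc$ is a loop around the fourth puncture (class of $(0,0)$). Explicitly, the word of an oriented curve (up to cyclic permutation) is read by following a lift in $\mathbb{R}^2\setminus\mathbb{Z}^2$ and recording $a^{\pm1}$, $b^{\pm1}$, $c^{\pm1}$ at each crossing with a line $\{y=2k\}$, $\{x=2k\}$, $\{x+y=2k\}$ ($k\in\mathbb{Z}$) respectively. The sign is given by a $\Gamma$-invariant transverse orientation on the segments cut out on these lines by $\mathbb{Z}^2$, determined by: crossing the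 open segment from $(0,0)$ to $(1,0)$ upward gives $a$; crossing the open segment from $(0,0)$ to $(0,1)$ towards decreasing $x$ gives $b$; crossing the open segment from $(0,2)$ to $(1,1)$ towards increasing $x+y$ gives $c$. A closed curve is simple if it is freely homotopic to a curve without self-intersection and bounds neither a disk nor a once-punctured disk. $\mathcal{S}(S_{0,4})$ is the set of free homotopy classes of unoriented simple closed curves, and $\gamma\in\mathcal{S}(S_{0,4})$ also denotes a cyclically reduced word in $\mathbb{F}_3$ representing it. Every simple closed curve is homotopic to the image of a straight line of slope in $\mathbb{Q}\cup\{\infty\}$ avoiding $\mathbb{Z}^2$; this slope is denoted $\mathrm{Slope}(\gamma)$ and $\mathrm{Slope}:\mathcal{S}(S_{0,4})\to\mathbb{Q}\cup\{\infty\}$ is a bijection. $|\cdot|$ is reduced word length, $\Vert\cdot\Vert$ cyclically reduced word length. Special lengths: write $\mathrm{Slope}(\gamma)=[n_1,\dots,n_r]=n_1+\frac{1}{n_2+\frac1{\ddots+\frac1{n_r}}}$ with $n_1\in\mathbb{Z}$, $n_2,\dots,n_r\ge1$ and $n_r\ge2$ if $r\ge2$; $r(\gamma)=r$. For $1\le i\le r$ let $\gamma_i\in\mathcal{S}(S_{0,4})$ have slope $[n_1,\dots,n_i]$, and let $\gamma_0$ have slope $0$. Then $l_i(\gamma)=\frac12\Vert\gamma_i\Vert$ for $0\le i\le r$. *)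

(* Defs.v *)
From HB Require Import structures.
From mathcomp Require Import all_boot all_order all_algebra.
From mathcomp Require Import all_classical all_reals all_analysis.

Set Implicit Arguments.
Unset Strict Implicit.
Unset Printing Implicit Defensive.

Import Order.TTheory GRing.Theory Num.Theory.
Import numFieldNormedType.Exports.

Local Open Scope classical_set_scope.
Local Open Scope ring_scope.

(** * Words in the free group on a, b, c *)

Inductive gen := Ga | Gb | Gc.

(* [(g, true)] is the generator [g] and [(g, false)] its inverse. *)
Definition letter := (gen * bool)%type.
Definition word := seq letter.

Definition linv (x : letter) : letter := (x.1, ~~ x.2).
Definition winv (w : word) : word := rev (map linv w).

Definition reduced (w : word) : Prop :=
  forall (p s : word) (x : letter), w <> p ++ [:: x; linv x] ++ s.

Definition cyclically_reduced (w : word) : Prop :=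
  reduced w /\ forall (m : word) (x : letter), w <> x :: rcons m (linv x).

Definition subword (v w : word) : Prop := exists p s : word, w = p ++ v ++ s.

(** * Closed curves on the four-punctured sphere

    S_{0,4} is the quotient of R^2 \ Z^2 by Gamma, which acts freely and
    properly discontinuously. Maps from R, from [0,1] x R and from ]0,1] x R to
    S_{0,4} are all given by lifts to R^2 \ Z^2, and two points of R^2 \ Z^2 have
    the same image in S_{0,4} iff they are related by [same_orbit]. *)

Section Curves.
Variable R : realType.

Definition lat (v : int * int) : R * R := (v.1%:~R, v.2%:~R).

(* Gamma consists of the maps x |-> x + 2v and x |-> - x + 2v, v in Z^2. *)
Definition same_orbit (x y : R * R) : Prop :=
  exists v : int * int, y = x + lat v *+ 2 \/ y = - x + lat v *+ 2.

Definition unpunctured (x : R * R) : Prop := forall v : int * int, x <> lat v.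

(* [c] is a lift of a closed curve, parametrized by R / Z. *)
Definition closed_curve (c : R -> R * R) : Prop :=
  [/\ continuous c,
      forall t, unpunctured (c t) &
      forall t, same_orbit (c t) (c (t + 1))].

Definition freely_homotopic (c d : R -> R * R) : Prop :=
  exists H : R * R -> R * R,
    [/\ {within `[0, 1] `*` [set: R], continuous H},
        forall s t, 0 <= s <= 1 -> unpunctured (H (s, t)),
        forall s t, 0 <= s <= 1 -> same_orbit (H (s, t)) (H (s, t + 1)),
        forall t, same_orbit (H (0, t)) (c t) &
        forall t, same_orbit (H (1, t)) (d t)].

Definition embedded (c : R -> R * R) : Prop :=
  forall t t', same_orbit (c t) (c t') -> exists k : int, t - t' = k%:~R.

(* [D (r, t)] is a lift of the point with polar coordinates [r], [2 pi t] of a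
   closed disk embedded in the sphere R^2 / Gamma with centre the image of [v],
   and without punctures except possibly at its centre: it is a disk in S_{0,4}
   if [v] is not in Z^2, and a once-punctured disk otherwise. *)
Definition bounds_disk (c : R -> R * R) : Prop :=
  exists (v : R * R) (D : R * R -> R * R),
    [/\ {within `]0, 1] `*` [set: R], continuous D},
        forall r t, 0 < r <= 1 ->
          unpunctured (D (r, t)) /\ ~ same_orbit v (D (r, t)),
        forall r t r' t', 0 < r <= 1 -> 0 < r' <= 1 ->
          (same_orbit (D (r, t)) (D (r', t')) <->
           r = r' /\ exists k : int, t - t' = k%:~R),
        forall e, 0 < e -> exists2 d, 0 < d &
          forall r t, 0 < r <= 1 -> r < d -> `|D (r, t) - v| < e &
        forall t, same_orbit (D (1, t)) (c t)].

Definition simple_closed_curve (c : R -> R * R) : Prop :=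
  closed_curve c /\
  exists d, [/\ closed_curve d, freely_homotopic c d, embedded d &
                ~ bounds_disk d].

(** * Slopes *)

(* For [v] primitive, the stabilizer in Gamma of a line of direction [v]
   avoiding Z^2 is generated by the translation by [2v]; hence the factor 2. *)
Definition line (x : R * R) (v : int * int) (t : R) : R * R :=
  (x.1 + t * (2 * v.1%:~R), x.2 + t * (2 * v.2%:~R)).

(* The slope of a direction, [None] standing for infinity. *)
Definition dir_slope (v : int * int) : option rat :=
  if v.1 == 0 then None else Some (v.2%:~R / v.1%:~R).

(* Both [v] and [- v] are allowed: curves are unoriented. *)
Definition has_slope (c : R -> R * R) (s : option rat) : Prop :=
  exists (x : R * R) (v : int * int),
    [/\ coprimez v.1 v.2, dir_slope v = s,
        forall t, unpunctured (line x v t) & freely_homotopic c (line x v)].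

(** * The word of a curve *)

(* The lines of type [g] are the [height g = 2k], k in Z. *)
Definition height (g : gen) (z : R * R) : R :=
  match g with Ga => z.2 | Gb => z.1 | Gc => z.1 + z.2 end.

Definition on_line (g : gen) (z : R * R) : Prop :=
  exists k : int, height g z = (2 * k)%:~R.

(* A coordinate along the lines of type [g], whose integral values on such a
   line are taken exactly at the points of Z^2. *)
Definition along (g : gen) (z : R * R) : R :=
  match g with Ga => z.1 | Gb => z.2 | Gc => z.1 end.

Definition crosses_up (g : gen) (c : R -> R * R) (t : R) : Prop :=
  on_line g (c t) /\
  \forall u \near t, (u < t -> height g (c u) < height g (c t)) /\
                     (t < u -> height g (c t) < height g (c u)).

Definition crosses_down (g : gen) (c : R -> R * R) (t : R) : Prop :=
  on_line g (c t) /\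
  \forall u \near t, (u < t -> height g (c t) < height g (c u)) /\
                     (t < u -> height g (c u) < height g (c t)).

(* [true] if crossing at [z] in the direction of increasing height gives [g],
   [false] if it gives its inverse. On the three segments used to normalize the
   transverse orientation, the floor of [along] is 0. Translations by 2Z^2
   preserve both its parity and the direction of increasing height, while
   x |-> - x reverses both, so this is Gamma-invariant. *)
Definition up_sign (g : gen) (z : R * R) : bool :=
  let even := (2 %| Num.floor (along g z))%Z in
  match g with Gb => ~~ even | _ => even end.

Definition crosses (c : R -> R * R) (t : R) (x : letter) : Prop :=
  if x.2 == up_sign x.1 (c t) then crosses_up x.1 c t
  else crosses_down x.1 c t.

(* [w] is the word recorded along [c] over the period [0, 1[. *)
Definition reads (c : R -> R * R) (w : word) : Prop :=
  exists ts : seq R,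
    [/\ sorted <%R ts,
        forall t, t \in ts <-> 0 <= t < 1 /\ exists g, on_line g (c t),
        size ts = size w &
        forall (i : nat) (x0 : letter), (i < size w)%N ->
          crosses c (nth 0 ts i) (nth x0 w i)].

(* [w] is a cyclically reduced word representing the element of S(S_{0,4}) of
   slope [s]. All such words are covered, since [c] ranges over the whole free
   homotopy class and over both orientations. *)
Definition simple_word (w : word) (s : option rat) : Prop :=
  cyclically_reduced w /\
  exists c, [/\ simple_closed_curve c, has_slope c s & reads c w].

End Curves.

(** * Continued fractions and special lengths *)

(* Since 0^-1 = 0, [cfrac [:: n]] is [n]. *)
Definition cfrac (ns : seq int) : rat :=
  foldr (fun (n : int) (x : rat) => n%:~R + x^-1) 0 ns.

Definition cf_expansion (ns : seq int) : Prop :=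
  [/\ (0 < size ns)%N,
      forall k, (0 < k < size ns)%N -> 1 <= nth 0 ns k &
      (2 <= size ns)%N -> 2 <= last 0 ns].

(* [l] is the special length l_i of the simple curves of slope [cfrac ns]; for
   i = 0 the curve has slope [cfrac [::] = 0], as it should. *)
Definition special_length (R : realType) (ns : seq int) (i l : nat) : Prop :=
  exists g : word, simple_word R g (Some (cfrac (take i ns))) /\ size g = l.*2.

(* Main.v *)
Require Import Defs.
From HB Require Import structures.
From mathcomp Require Import all_boot all_order all_algebra.
From mathcomp Require Import all_classical all_reals all_analysis.
From mathcomp Require Import zify ring lra.

(**
  Homotopies of curves are sampled on a fine grid: between two nearby points away
  from Z^2 at most one crossing takes place, so crossings define a cocycle with
  values in the free group, and freely homotopic curves read conjugate words.
  Cyclically reduced conjugate words are rotations of each other; hence a simple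
  word is, up to rotation, the periodic word read along a straight line.

  Let v = a f + b f' be the direction of the line, where f and f' are the vectors
  of two successive convergents of its slope, and let 2 l be the length of the word
  of f. A letter is determined by the segment cut out by Z^2 that is crossed, and a
  run of l - 5 crossings only involves segments whose upper end points lie, relative
  to v, at least a above the lower ones, by the best approximation property of
  convergents. The line therefore
  also crosses, in the same order, the translates of these segments by 2 m, or their
  reflections in a lattice point, as soon as the displacement transverse to v lies
  in an interval of length a for each of the two kinds of motion. Together the two
  intervals form a fundamental domain modulo 2 a, so for each i some j makes the
  displacement by m = i f + j f' admissible. This yields a copy of the run or of
  its inverse in every window of length 6 l.
*)

Set Implicit Arguments.
Unset Strict Implicit.
Unset Printing Implicit Defensive.

Import Order.TTheory GRing.Theory Num.Theory.
Import numFieldNormedType.Exports.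

Local Open Scope classical_set_scope.
Local Open Scope ring_scope.

(** * Conjugacy in the free group *)

(** Two linear functions of a lattice vector m govern the effect of moving a segment by 2m: [side]
    decides whether the line crosses the moved segment, [lindex] decides at which place of the word
    this crossing is read. The crossing counter [index] makes sense on the whole plane, is constant
    on every open segment, and changes explicitly under Gamma; this is how moved crossings are known
    to be consecutive without following the line between them.

    Constants: an end of a segment crossed at number N has [lindex] between 2N - 1 and 2N + 5, so
    two ends within a run of n crossings differ by at most 2n + 4, which is less than 2l for n = l -
    5. The starting places of the copies increase by steps between 1 and 5l, hence a window of
    length 6l holds a complete copy. Ten partial quotients force l >= 9. With q the number of full
    windows, q >= 1 and |gamma| < 6l(q + 1) <= 12ql <= 30q(l - 5), the last inequality by l >= 9. *)

Definition gen_eq (g h : gen) : bool :=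
  match g, h with Ga, Ga | Gb, Gb | Gc, Gc => true | _, _ => false end.

Lemma gen_eqP : Equality.axiom gen_eq.
Proof. by case; case; constructor. Qed.

HB.instance Definition _ := hasDecEq.Build gen gen_eqP.

Lemma linvK : involutive linv.
Proof. by case=> g b; rewrite /linv /= negbK. Qed.

Lemma linv_neq x : linv x != x.
Proof. by case: x => g [] /=; apply/eqP => -[]. Qed.

Definition noncancel (x y : letter) : bool := y != linv x.

(* The left action of the free group on its reduced words: two words represent
   the same element iff they act in the same way. *)
Definition push (x : letter) (u : word) : word :=
  if u is y :: u' then if y == linv x then u' else x :: u else [:: x].

Definition act (u x : word) : word := foldr push x u.

Lemma act_cat u v x : act (u ++ v) x = act u (act v x).
Proof. exact: foldr_cat. Qed.

Lemma push_reduced x u : sorted noncancel u -> sorted noncancel (push x u).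
Proof.
case: u => //= y u' pu; case: eqP => [_|/eqP yx]; first exact: path_sorted pu.
by rewrite /= {1}/noncancel yx.
Qed.

Lemma act_reduced u x : sorted noncancel x -> sorted noncancel (act u x).
Proof. by move=> rx; elim: u => //= y u; apply: push_reduced. Qed.

Lemma pushK x u : sorted noncancel u -> push (linv x) (push x u) = u.
Proof.
case: u => [|y u'] /= pu; first by rewrite linvK eqxx.
have [yx|yx] := eqVneq y (linv x); last by rewrite /= linvK eqxx.
case: u' pu => [|z u'] /=; first by rewrite yx.
by rewrite yx /noncancel => /andP[/negPf ->].
Qed.

Lemma pushVK x u : sorted noncancel u -> push x (push (linv x) u) = u.
Proof. by move=> ru; rewrite -{1}(linvK x) pushK. Qed.

Lemma act_nil u : sorted noncancel u -> act u [::] = u.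
Proof.
elim: u => //= x u IHu pu; rewrite IHu ?(path_sorted pu) //.
by case: u pu {IHu} => //= y u /andP[/negPf ->].
Qed.

Lemma act_act u y x : sorted noncancel x -> act (act u y) x = act u (act y x).
Proof.
move=> rx; elim: u => //= a u <-; case: (act u y) => //= b v.
by case: eqP => // ->; rewrite pushVK ?act_reduced.
Qed.

(** The equation u w = w' u in the free group, tested through the action. *)
Definition conj_by (u w w' : word) :=
  forall x, sorted noncancel x -> act u (act w x) = act w' (act u x).

Lemma cycle_noncancel_sorted w : cycle noncancel w -> sorted noncancel w.
Proof. by case: w => //= x w; rewrite rcons_path => /andP[]. Qed.

Lemma conj_by_rot1r x u w w' :
  conj_by (x :: u) w (x :: w') -> conj_by u w (rcons w' x).
Proof.
move=> h y ry; rewrite -cats1 act_cat /=.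
have /= := congr1 (push (linv x)) (h y ry).
by rewrite !pushK ?(act_reduced, push_reduced).
Qed.

Lemma conj_by_rotr1r x u w w' :
  conj_by (x :: u) w (rcons w' (linv x)) -> conj_by u w (linv x :: w').
Proof.
move=> h y ry; have /= := congr1 (push (linv x)) (h y ry).
by rewrite -cats1 act_cat /= !pushK ?(act_reduced, push_reduced).
Qed.

Lemma conj_by_rot1l x u w w' :
  conj_by (rcons u x) (linv x :: w) w' -> conj_by u (rcons w (linv x)) w'.
Proof.
move=> h y ry; have ry' := push_reduced (linv x) ry.
have := h _ ry'; rewrite -!cats1 !act_cat /=.
by rewrite !pushVK ?(act_reduced, push_reduced).
Qed.

Lemma cycle_rcons_cons x w :
  cycle noncancel (x :: w) = cycle noncancel (rcons w x).
Proof. by rewrite -(rot_cycle 1) rot1_cons. Qed.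

Lemma sorted_rcons_cons u x y w : sorted noncancel (rcons u x) ->
  sorted noncancel (y :: w) -> noncancel x y ->
  sorted noncancel (rcons u x ++ y :: w).
Proof.
case: u => [|z u] /= pu pw xy; first by rewrite xy.
by rewrite cat_path pu last_rcons /= xy.
Qed.

(* Each step removes the first or the last letter of [u], at the cost of
   rotating [w] or [w'] by one letter. *)
Lemma conj_by_rot_reduced u w w' : sorted noncancel u ->
    cycle noncancel w -> cycle noncancel w' -> conj_by u w w' ->
  exists n, w = rot n w'.
Proof.
elim: {u}(size u) {-2}u (leqnn (size u)) w w' => [|k IHk] u.
  rewrite leqn0 => /nilP -> w w' _ cw cw' /(_ [::] isT) /=.
  rewrite !act_nil ?cycle_noncancel_sorted // => ->; exists 0%N.
  by rewrite rot0.
case: u => [|x u] su w w' ru cw cw' h; first exact: (IHk [::]).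
have ru1 : sorted noncancel u by apply: path_sorted ru.
have [rw rw'] := (cycle_noncancel_sorted cw, cycle_noncancel_sorted cw').
have rots a b (v : word) : exists n, rot a (rot b v) = rot n v.
  by exists (rot_add v b a); rewrite rot_rot_add.
have [w'0|nz] := eqVneq w' [::].
  move: h; rewrite w'0 => h; exists 0%N.
  have := h [::] isT; rewrite -[act [::] _]/(act (x :: u) [::]).
  move=> /(congr1 (act (map linv (rev (x :: u))))).
  have K v z : sorted noncancel z -> act (map linv (rev v)) (act v z) = z.
    move=> rz; elim: v => //= a v IHv; rewrite rev_cons map_rcons -cats1.
    by rewrite act_cat /= pushK ?act_reduced.
  by rewrite !K ?act_reduced // act_nil.
case: (lastP w') nz cw' rw' h => // w0 z _ cw' rw' h.
have [zx|zx] := eqVneq z (linv x).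
  rewrite zx in h cw' *; have cw1 : cycle noncancel (linv x :: w0).
    by rewrite cycle_rcons_cons.
  have [n ->] := IHk u su _ _ ru1 cw cw1 (conj_by_rotr1r h).
  by rewrite -rotr1_rcons; exact: rots.
case def_w': (rcons w0 z) cw' rw' h => [|y w1] cw' rw' h; first by case: w0 def_w'.
have [yx|yx] := eqVneq y x.
  rewrite yx in h cw' *; have cw1 : cycle noncancel (rcons w1 x).
    by rewrite -cycle_rcons_cons.
  have [n ->] := IHk u su _ _ ru1 cw cw1 (conj_by_rot1r h).
  by rewrite -rot1_cons; exact: rots.
(* No letter cancels between [w'] and [u], so the right side of u w = w' u is already reduced and
   starts with [y], not [x]. If nothing cancelled in u w either, that side would start with [x]; so
   [w] must start with the inverse of the last letter of [u]. *)
have rw'u : sorted noncancel ((y :: w1) ++ x :: u).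
  rewrite -def_w'; apply: sorted_rcons_cons => //; first by rewrite def_w'.
  by rewrite /noncancel; apply: contra zx => /eqP ->; rewrite linvK.
have E := h [::] isT; rewrite -!act_cat (act_nil rw'u) in E.
case: w cw rw h E => [|t w] cw rw h E.
  move: E; rewrite cats0 act_nil // => -[]; move/eqP; rewrite eq_sym.
  by rewrite (negPf yx).
case/lastP def_u : {-}(x :: u) => [//|u0 q].
have [tq|tq] := eqVneq t (linv q); last first.
  have ruw : sorted noncancel ((x :: u) ++ t :: w).
    by rewrite def_u; apply: sorted_rcons_cons => //; rewrite -def_u.
  move: E; rewrite (act_nil ruw) => -[] /eqP.
  by rewrite eq_sym (negPf yx).
rewrite def_u tq in h ru cw.
have cw1 : cycle noncancel (rcons w (linv q)) by rewrite -cycle_rcons_cons.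
have su0 : (size u0 <= k)%N.
  by move: su => /=; have /= -> := congr1 size def_u; rewrite size_rcons.
have ru0 : sorted noncancel u0.
  by move: ru; rewrite -cats1 => /cat_sorted2[].
have [n En] := IHk u0 su0 _ _ ru0 cw1 cw' (conj_by_rot1l h).
by rewrite tq -rotr1_rcons En /rotr; exact: rots.
Qed.

(** Only the group element of [u] matters, so [u] is replaced by its reduced form [act u [::]]. *)
Lemma conj_by_rot u w w' :
    cycle noncancel w -> cycle noncancel w' -> conj_by u w w' ->
  exists n, w = rot n w'.
Proof.
move=> cw cw' h; apply: (@conj_by_rot_reduced (act u [::])) => //.
  exact: act_reduced.
by move=> x rx; rewrite !act_act ?act_reduced //; exact: h.
Qed.

Lemma cyclically_reduced_cycle w : cyclically_reduced w -> cycle noncancel w.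
Proof.
case=> rw cw; have sw : sorted noncancel w.
  case: w rw {cw} => //= x w; elim: w x => //= y w IHw x rw; apply/andP; split.
    apply/eqP => yx; apply: (rw [::] w x); by rewrite /= yx.
  apply: IHw => p s z E; apply: (rw (x :: p) s z); by rewrite E.
case: w sw cw {rw} => //= x w sw cw; rewrite rcons_path sw /=.
case/lastP: w sw cw => [|w y] sw cw; first by rewrite /= /noncancel eq_sym linv_neq.
rewrite last_rcons; apply/eqP => xy; apply: (cw w x).
by rewrite xy linvK.
Qed.

(** * The crossing cocycle *)

Lemma pair_ext (A B : Type) (z z' : A * B) : z.1 = z'.1 -> z.2 = z'.2 -> z = z'.
Proof. by case: z z' => [x y] [x' y'] /= -> ->. Qed.

Section Cocycle.
Variable R : realType.
Implicit Types (z : R * R) (g : gen) (d x y : R).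

Definition hfloor g z : int := Num.floor (height g z / 2).

Definition lheight g (v : int * int) : int :=
  match g with Ga => v.2 | Gb => v.1 | Gc => v.1 + v.2 end.

Lemma height_lat g v : height g (lat R v) = (lheight g v)%:~R.
Proof. by case: g => //=; rewrite intrD. Qed.

Lemma heightD g z z' : height g (z + z') = height g z + height g z'.
Proof. by case: g => //=; rewrite addrACA. Qed.

Lemma heightN g z : height g (- z) = - height g z.
Proof. by case: g => //=; rewrite opprD. Qed.

Lemma alongD g z z' : along g (z + z') = along g z + along g z'.
Proof. by case: g. Qed.

Lemma alongN g z : along g (- z) = - along g z.
Proof. by case: g. Qed.

Definition lalong g (v : int * int) : int :=
  match g with Ga => v.1 | Gb => v.2 | Gc => v.1 end.

Lemma along_lat g v : along g (lat R v) = (lalong g v)%:~R.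
Proof. by case: g. Qed.

Lemma hfloor_ge g z (k : int) : (k <= hfloor g z) = ((2 * k)%:~R <= height g z).
Proof. by rewrite /hfloor floor_ge_int intrM; apply/idP/idP; lra. Qed.

Lemma hfloor_lt g z (k : int) : (hfloor g z < k) = (height g z < (2 * k)%:~R).
Proof. by rewrite ltNge hfloor_ge -ltNge. Qed.

Lemma floor_le_near x y d : (forall n : int, d <= `|x - n%:~R|) -> `|y - x| < d ->
  Num.floor x <= Num.floor y.
Proof.
move=> fx yx; rewrite floor_ge_int leNgt; apply/negP => y_lt.
have := fx (Num.floor x); have /andP[x_ge _] := floor_itv x.
have := ler_norm (x - y); rewrite distrC => ?.
rewrite ger0_norm ?subr_ge0 // => ?; lra.
Qed.

Lemma floor_near x y d : (forall n : int, d <= `|x - n%:~R|) -> `|y - x| < d ->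
  Num.floor y = Num.floor x.
Proof.
move=> fx yx; apply/eqP; rewrite eq_le (floor_le_near fx) // andbT.
rewrite -ltzD1 floor_lt_int; have /andP[_ x_lt] := floor_itv x.
have := fx (Num.floor x + 1); rewrite ler0_norm ?subr_le0 ?(ltW x_lt) // => ?.
by have := ler_norm (y - x); lra.
Qed.

Lemma hfloor_near g z z' d : (forall n : int, d <= `|height g z - n%:~R|) ->
  `|height g z' - height g z| < d -> hfloor g z' = hfloor g z.
Proof.
move=> fz zz'; apply: (@floor_near _ _ (d / 2)) => [n|].
  have -> : height g z / 2 - n%:~R = (height g z - (2 * n)%:~R) / 2.
    by rewrite intrM; lra.
  by rewrite normrM (ger0_norm (_ : 0 <= 2^-1)) //; have := fz (2 * n); lra.
by rewrite -mulrBl normrM (ger0_norm (_ : 0 <= 2^-1)) //; lra.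
Qed.

(** The norm is the sup norm. Later uses take [separated (2 * d)]: knowing two heights up to d fixes
    the coordinates only up to 2d, since [height Gc] is a sum of two of them. *)
Definition separated d z := forall m, d <= `|z - lat R m|.

Lemma prod_norm_lt z d : (`|z| < d) = (`|z.1| < d) && (`|z.2| < d).
Proof. by rewrite prod_normE /= gt_max. Qed.

Lemma height_lt g z d : `|z| < d -> `|height g z| < 2 * d.
Proof.
rewrite prod_norm_lt => /andP[z1 z2]; have := normr_ge0 z.1.
by have := ler_normD z.1 z.2; case: g => /=; lra.
Qed.

Lemma along_lt g z d : `|z| < d -> `|along g z| < d.
Proof. by rewrite prod_norm_lt => /andP[z1 z2]; case: g. Qed.

Definition meet g g' (n n' : int) : int * int :=
  match g, g' with
  | Ga, Gb => (n', n) | Ga, Gc => (n' - n, n)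
  | Gb, Ga => (n, n') | Gb, Gc => (n, n' - n)
  | Gc, Ga => (n - n', n') | Gc, Gb => (n', n - n')
  | _, _ => (0, 0)
  end.

(* Lines of different types, and the integral points of [along] on them, meet
   only in [Z^2]; so near one line a point avoiding [Z^2] is far from the others. *)
Lemma separated_height g g' z d (n n' : int) : separated (2 * d) z -> g != g' ->
  `|height g z - n%:~R| < d -> d <= `|height g' z - n'%:~R|.
Proof.
move=> sz gg' zn; rewrite leNgt; apply/negP => zn'.
have := sz (meet g g' n n'); rewrite leNgt prod_norm_lt => /negP; apply.
move: zn zn'; rewrite !ltr_norml.
by case: g gg'; case: g' => //= _ /andP[? ?] /andP[? ?]; rewrite ?intrB;
  apply/andP; split; apply/andP; split; lra.
Qed.

Lemma separated_along g z d (n n' : int) : separated (2 * d) z ->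
  `|height g z - n%:~R| < d -> d <= `|along g z - n'%:~R|.
Proof.
move=> sz zn; pose g' := if g is Ga then Gb else if g is Gb then Ga else Gb.
have -> : along g z = height g' z by rewrite /g'; case: (g).
by apply: separated_height zn => //; rewrite /g'; case: (g).
Qed.

Lemma separated_lt1 z d : separated (2 * d) z -> 2 * d < 1.
Proof.
move=> /(_ (Num.floor z.1, Num.floor z.2)) /le_lt_trans; apply.
rewrite prod_norm_lt /=; have := floor_itv z.1; have := floor_itv z.2.
by rewrite !intrD => /andP[? ?] /andP[? ?]; rewrite !ger0_norm; lra.
Qed.

(** The letter suggested by comparing the strips of two sample points. The sign is taken at the
    starting point instead of the crossing point; this is legitimate only for close points far from
    the lattice. *)
Definition step1 g z z' : word :=
  if hfloor g z < hfloor g z' then [:: (g, up_sign g z)]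
  else if hfloor g z' < hfloor g z then [:: (g, ~~ up_sign g z)] else [::].

Definition step z z' : word := step1 Ga z z' ++ step1 Gb z z' ++ step1 Gc z z'.

Lemma step1_nil g z z' : hfloor g z = hfloor g z' -> step1 g z z' = [::].
Proof. by rewrite /step1 => ->; rewrite ltxx. Qed.

Lemma step_step1 g z z' : (forall g', g' != g -> hfloor g' z = hfloor g' z') ->
  step z z' = step1 g z z'.
Proof.
rewrite /step; case: g => h.
- by rewrite (step1_nil (h Gb isT)) (step1_nil (h Gc isT)) !cats0.
- by rewrite (step1_nil (h Ga isT)) (step1_nil (h Gc isT)) cats0.
- by rewrite (step1_nil (h Ga isT)) (step1_nil (h Gb isT)).
Qed.

Lemma hfloor_neq_near g z z' : hfloor g z <> hfloor g z' ->
  exists k : int, `|height g z - (2 * k)%:~R| <= `|height g z' - height g z|.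
Proof.
wlog zz' : z z' / hfloor g z < hfloor g z' => [wl|] neq.
  have /orP[?|lt] : (hfloor g z < hfloor g z') || (hfloor g z' < hfloor g z).
  - by rewrite -neq_lt; apply/eqP.
  - exact: wl.
  - exists (hfloor g z).
    have /andP[zk _] : ((2 * hfloor g z)%:~R <= height g z) && true.
      by rewrite -hfloor_ge lexx.
    by rewrite hfloor_lt in lt; rewrite ger0_norm ?ltr0_norm; lra.
exists (hfloor g z'); have zk : (2 * hfloor g z')%:~R <= height g z'.
  by rewrite -hfloor_ge.
by rewrite hfloor_lt in zz'; rewrite ltr0_norm ?ger0_norm; lra.
Qed.

(* All crossings within a small set [S] far from [Z^2] are on one segment; [up]
   says on which side of it a point lies. *)
Lemma step_chart (S : set (R * R)) d :
    (forall z, S z -> separated (2 * d) z) ->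
    (forall z z', S z -> S z' -> `|z' - z| < d / 4) ->
  exists (g : gen) (b : bool) (up : R * R -> bool), forall z z', S z -> S z' ->
    step z z' = if up z == up z' then [::] else [:: (g, b == up z')].
Proof.
move=> sepS nearS.
have [[[[g z0] z1] /= [Sz0 Sz1 neq]]|same] := pselect (exists t : gen * (R * R) * (R * R),
    [/\ S t.1.2, S t.2 & hfloor t.1.1 t.1.2 <> hfloor t.1.1 t.2]); last first.
  exists Ga, true, xpredT => z z' Sz Sz'; rewrite eqxx.
  by rewrite /step !step1_nil //; apply: contrapT => h; apply: same;
     [exists (Gc, z, z')|exists (Gb, z, z')|exists (Ga, z, z')].
have hdist z z' g' : S z -> S z' -> `|height g' z' - height g' z| < d / 2.
  move=> Sz Sz'; rewrite -heightN -heightD.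
  by have := height_lt g' (nearS z z' Sz Sz'); lra.
have [k zk] := hfloor_neq_near neq.
(* Two points within d/4 have heights within d/2. As some pair of points of [S] lies in different
   strips, every point of [S] is within d/2 + d/2 of the line crossed. *)
have Sk z : S z -> `|height g z - (2 * k)%:~R| < d.
  move=> Sz; have := hdist _ _ g Sz0 Sz1; have := hdist _ _ g Sz0 Sz.
  have := ler_normD (height g z - height g z0) (height g z0 - (2 * k)%:~R).
  by rewrite subrKA; lra.
have d_gt0 : 0 < d by apply: le_lt_trans (Sk _ Sz0).
have upS z : S z -> up_sign g z = up_sign g z0.
  move=> Sz; rewrite /up_sign.
  suff -> : Num.floor (along g z) = Num.floor (along g z0) by [].
  apply: (@floor_near _ _ d) => [n|].
    by apply: separated_along (Sk _ Sz0); exact: sepS.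
  rewrite -alongN -alongD.
  by have := along_lt g (nearS _ _ Sz0 Sz); lra.
have othS z g' : S z -> g' != g -> hfloor g' z = hfloor g' z0.
  move=> Sz g'g; apply: (@hfloor_near _ _ _ d) => [n|].
    by apply: separated_height (Sk _ Sz0); [exact: sepS|rewrite eq_sym].
  by have := hdist _ _ g' Sz0 Sz; lra.
pose up (z : R * R) := ((2 * k)%:~R <= height g z).
have fl z : S z -> hfloor g z = if up z then k else k - 1.
  move=> Sz; have := Sk z Sz; have := separated_lt1 (sepS z Sz).
  rewrite /up ltr_norml intrM => d1 /andP[zl zr].
  case: lerP => ?; apply: floor_def;
    by rewrite ?subrK ?intrD ?intrB; apply/andP; split; lra.
exists g, (up_sign g z0), up => z z' Sz Sz'.
rewrite (@step_step1 g) => [|g' g'g]; last by rewrite !othS.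
rewrite /step1 !fl // upS //; case: (up z) (up z') => -[] /=; rewrite ?ltxx //.
- by rewrite ltNge lerBlDr lerDl ler01 /= ltrBlDr ltrDl ltr01 eqbF_neg.
- by rewrite ltrBlDr ltrDl ltr01 eqb_id.
Qed.

End Cocycle.

(** * Homotopic curves have conjugate words *)

Section Grid.
Variable R : realType.
Implicit Types (z : R * R) (g : gen) (a b : nat -> R * R).

Definition eqv (u v : word) := forall x, sorted noncancel x -> act u x = act v x.

(** In one chart a step is trivial or one letter or its inverse, according to the sides of its two
    ends; the contributions therefore telescope. *)
Lemma step_cocycle (S : set (R * R)) (d : R) z0 z1 z2 :
    (forall z, S z -> separated (2 * d) z) ->
    (forall z z', S z -> S z' -> `|z' - z| < d / 4) ->
    S z0 -> S z1 -> S z2 ->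
  eqv (step z0 z1 ++ step z1 z2) (step z0 z2).
Proof.
move=> sepS nearS S0 S1 S2 x rx; have [g [c [up E]]] := step_chart sepS nearS.
rewrite act_cat !E //; move: (up z0) (up z1) (up z2) => u0 u1 u2.
have inv (e : bool) : push (g, e) (push (g, ~~ e) x) = x.
  exact: (@pushVK (g, e)).
case: u0 u1 u2 => -[] [] //=; rewrite ?eqb_id ?eqbF_neg //.
by rewrite -{2}(negbK c).
Qed.

Fixpoint row a (m : nat) : word :=
  if m is m'.+1 then row a m' ++ step (a m') (a m) else [::].

(** Induction over the squares of a strip of the grid: commuting squares are glued along their
    common rungs. *)
Lemma row_ladder a b m :
    (forall j, (j < m)%N -> eqv (step (a j) (b j) ++ step (b j) (b j.+1))
                                (step (a j) (a j.+1) ++ step (a j.+1) (b j.+1))) ->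
  eqv (step (a 0%N) (b 0%N) ++ row b m) (row a m ++ step (a m) (b m)).
Proof.
elim: m => [|m IHm] h x rx; first by rewrite /= cats0.
rewrite /= catA act_cat IHm ?act_reduced // => [|j jm]; last exact/h/ltnW.
by rewrite act_cat -[act (step _ _) (act _ x)]act_cat h // -catA !act_cat.
Qed.

Lemma height_translate g z v :
  height g (z + lat R v *+ 2) = height g z + (2 * lheight g v)%:~R.
Proof. by rewrite mulr2n !heightD height_lat intrM; ring. Qed.

Lemma along_translate g z v :
  along g (z + lat R v *+ 2) = along g z + (2 * lalong g v)%:~R.
Proof. by rewrite mulr2n !alongD along_lat intrM; ring. Qed.

Lemma hfloor_translate g z v :
  hfloor g (z + lat R v *+ 2) = hfloor g z + lheight g v.
Proof.
rewrite /hfloor height_translate intrM.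
have -> : (height g z + 2%:~R * (lheight g v)%:~R) / 2 = height g z / 2 + (lheight g v)%:~R.
  by lra.
by rewrite floorDrz ?intrKfloor ?intr_int.
Qed.

Lemma up_sign_translate g z v : up_sign g (z + lat R v *+ 2) = up_sign g z.
Proof.
rewrite /up_sign along_translate floorDrz ?intr_int // intrKfloor.
by rewrite rpredDr ?dvdz_mulr.
Qed.

Lemma step_translate z z' v :
  step (z + lat R v *+ 2) (z' + lat R v *+ 2) = step z z'.
Proof.
suff E g : step1 g (z + lat R v *+ 2) (z' + lat R v *+ 2) = step1 g z z'.
  by rewrite /step !E.
by rewrite /step1 !hfloor_translate up_sign_translate !ltrD2r.
Qed.

Lemma conj_by_trans u u' w0 w1 w2 :
  conj_by u w1 w0 -> conj_by u' w2 w1 -> conj_by (u ++ u') w2 w0.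
Proof. by move=> h h' x rx; rewrite !act_cat h' // h ?act_reduced. Qed.

Variables (P : R * R -> R * R) (v : int * int) (d e : R).
Hypothesis P_period : forall s t, P (s, t + 1) = P (s, t) + lat R v *+ 2.
Hypothesis P_sep : forall s t, 0 <= s <= 1 -> -1 <= t <= 1 ->
  separated (2 * d) (P (s, t)).
Hypothesis P_unif : forall s t s' t', 0 <= s <= 1 -> -1 <= t <= 1 ->
  0 <= s' <= 1 -> -1 <= t' <= 1 -> `|s' - s| < e -> `|t' - t| < e ->
  `|P (s', t') - P (s, t)| < d / 4.

Lemma grid_conj (t0 : R) (m : nat) : -1 <= t0 <= 0 -> m.+1%:R^-1 < e ->
  let a i j := P (i%:R / m.+1%:R, t0 + j%:R / m.+1%:R) in
  exists u, conj_by u (row (a m.+1) m.+1) (row (a 0%N) m.+1).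
Proof.
move=> t0_bd me a; pose n := m.+1; rewrite -/n in me a *.
have n_gt0 : 0 < n%:R :> R by rewrite ltr0n.
have frac (i : nat) : (i <= n)%N -> 0 <= (i%:R / n%:R : R) <= 1.
  by move=> i_n; rewrite divr_ge0 //= ler_pdivrMr // mul1r ler_nat.
have fracS (i : nat) : i.+1%:R / n%:R = i%:R / n%:R + n%:R^-1 :> R.
  by rewrite -addn1 natrD mulrDl mul1r.
suff K k : (k <= n)%N -> exists u, conj_by u (row (a k) n) (row (a 0%N) n) by exact: K.
elim: k => [_|k IHk kn]; first by exists [::].
have [u hu] := IHk (ltnW kn); exists (u ++ step (a k 0%N) (a k.+1 0%N)).
apply: conj_by_trans hu _ => x rx.
rewrite -!act_cat.
(* The column at [t0 + 1] is the translate of the column at [t0], and steps are invariant under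
   translations by twice a lattice vector. *)
have -> : step (a k 0%N) (a k.+1 0%N) = step (a k n) (a k.+1 n).
  by rewrite /a mul0r addr0 divff ?gt_eqF // !P_period step_translate.
rewrite -[X in X = _](_ : act (step (a k 0%N) (a k.+1 0%N) ++ row (a k.+1) n) x = _); last first.
  by rewrite /a mul0r addr0 divff ?gt_eqF // !P_period step_translate.
apply: row_ladder => // j jn y ry.
pose S := [set P (p.1, p.2) | p in [set p : R * R |
   k%:R / n%:R <= p.1 <= k.+1%:R / n%:R /\
   t0 + j%:R / n%:R <= p.2 <= t0 + j.+1%:R / n%:R]].
have fk := frac k (ltnW kn); have fk1 := frac _ kn.
have fj := frac j (ltnW jn); have fj1 := frac _ jn.
have n_inv : 0 < n%:R^-1 :> R by rewrite invr_gt0.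
have sepS z : S z -> separated (2 * d) z.
  by move=> [[s t]] /= [/andP[? ?] /andP[? ?]] <-; apply: P_sep; lra.
have nearS z z' : S z -> S z' -> `|z' - z| < d / 4.
  move=> [[s t]] /= [/andP[? ?] /andP[? ?]] <-.
  move=> [[s' t']] /= [/andP[? ?] /andP[? ?]] <-.
  have := fracS k; have := fracS j => ? ?.
  by apply: P_unif; rewrite ?ltr_norml; lra.
have Sa i i' : (i = k \/ i = k.+1) -> (i' = j \/ i' = j.+1) -> S (a i i').
  move=> hi hi'; exists (i%:R / n%:R, t0 + i'%:R / n%:R) => //=.
  have := fracS k; have := fracS j.
  by case: hi hi' => -> [] -> ? ?; split; lra.
have S0 i' : i' = j \/ i' = j.+1 -> S (a k i') by apply: Sa; left.
have S1 i' : i' = j \/ i' = j.+1 -> S (a k.+1 i') by apply: Sa; right.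
have [[Sj SSj] [S'j S'Sj]] := ((S0 j (or_introl erefl), S0 _ (or_intror erefl)),
  (S1 j (or_introl erefl), S1 _ (or_intror erefl))).
by rewrite !(step_cocycle sepS nearS).
Qed.

End Grid.

(** * Words of sampled curves and recorded words *)

Section RowWord.
Variable R : realType.
Implicit Types (z : R * R) (g : gen) (p : R -> R * R).

Lemma pos_lower_bound (D : seq R) :
  exists2 m : R, 0 < m & forall x, x \in D -> 0 < x -> m <= x.
Proof.
elim: D => [|y D [m m_gt0 mD]]; first by exists 1.
have [y_gt0|y_le0] := ltP 0 y; last first.
  exists m => // x; rewrite in_cons => /orP[/eqP -> ?|/mD //]; lra.
exists (Num.min y m) => [|x]; first by rewrite lt_min y_gt0.
rewrite in_cons ge_min => /orP[/eqP -> _|xD x_gt0]; first by rewrite lexx.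
by rewrite mD ?orbT.
Qed.

Lemma avoid_finite (D : seq R) (a b : R) : a < b ->
  exists2 t, a < t < b & t \notin D.
Proof.
suff K : a < b -> exists a' b' : R, [/\ a <= a', a' < b', b' <= b &
    forall x, x \in D -> ~~ (a' < x < b')].
  case/K=> a' [b' [aa' ab bb' h]]; exists ((a' + b') / 2); first by lra.
  by apply/negP => /h /negP; apply; apply/andP; split; lra.
elim: D => [|y D IHD] ab; first by exists a, b.
have [a' [b' [aa' a'b' bb' h]]] := IHD ab.
have [/andP[ay yb]|hy] := boolP (a' < y < b').
  exists a', y; split => // [|x]; first lra.
  rewrite in_cons => /orP[/eqP ->|/h]; first by rewrite ltxx andbF.
  by apply: contra => /andP[-> ?]; rewrite /=; lra.
exists a', b'; split => // x; by rewrite in_cons => /orP[/eqP ->|/h].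
Qed.

Lemma continuous_fst p : continuous p -> continuous (fun t => (p t).1).
Proof. by move=> pc t; apply: cvg_comp (pc t) _; exact: cvg_fst. Qed.

Lemma continuous_snd p : continuous p -> continuous (fun t => (p t).2).
Proof. by move=> pc t; apply: cvg_comp (pc t) _; exact: cvg_snd. Qed.

Lemma continuous_height g p : continuous p -> continuous (fun t => height g (p t)).
Proof.
move=> pc; have [c1 c2] := (continuous_fst pc, continuous_snd pc).
by case: g => //= t; apply: cvgD; [exact: c1|exact: c2].
Qed.

Lemma hfloor_const g p (a b : R) : continuous p -> a <= b ->
  (forall t, a <= t <= b -> ~ on_line g (p t)) ->
  hfloor g (p a) = hfloor g (p b).
Proof.
move=> pc ab noline.
suff K (k : int) : ~ (Num.min (height g (p a)) (height g (p b)) <= (2 * k)%:~R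
    <= Num.max (height g (p a)) (height g (p b))).
  apply/eqP/contraT; rewrite neq_lt => /orP[lt|lt]; exfalso.
    apply: (K (hfloor g (p b))); have := lexx (hfloor g (p b)).
    rewrite hfloor_ge; rewrite hfloor_lt in lt => ge.
    by rewrite ge_min (ltW lt) le_max ge orbT.
  apply: (K (hfloor g (p a))); have := lexx (hfloor g (p a)).
  rewrite hfloor_ge; rewrite hfloor_lt in lt => ge.
  by rewrite ge_min (ltW lt) orbT le_max ge.
move=> hk; have [|t] := @IVT _ (fun t => height g (p t)) _ _ _ ab _ hk.
  by apply: continuous_subspaceT; exact: continuous_height.
by rewrite in_itv /= => tab tk; apply: (noline t) => //; exists k.
Qed.

Lemma unpunctured_on_line g g' z : unpunctured z -> on_line g z ->
  on_line g' z -> g = g'.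
Proof.
move=> uz [k zk] [k' zk']; apply/eqP/contraT => gg'; exfalso.
apply: (uz (meet g g' (2 * k) (2 * k'))); case: z uz zk zk' => x y /= _.
by case: g gg'; case: g' => //= _ zk zk'; rewrite /lat /= ?intrB -zk -zk';
  congr (_, _); lra.
Qed.

Lemma near_between (Q : R -> Prop) (a t b : R) : a < t < b ->
  (\forall u \near t, Q u) -> exists u u', [/\ a < u < t, t < u' < b, Q u & Q u'].
Proof.
move=> /andP[a_t t_b] /nbhs_ballP[e /= e_gt0 he].
pose m := Num.min e (Num.min (t - a) (b - t)).
have m_gt0 : 0 < m by rewrite !lt_min e_gt0 !subr_gt0 a_t.
have : m <= m by []; rewrite {2}/m !le_min => /and3P[? ? ?].
exists (t - m / 2), (t + m / 2); split; try lra; apply: he;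
  rewrite /ball /= ltr_norml; lra.
Qed.

Lemma step_crosses p (a t b : R) (x : letter) : continuous p ->
    (forall t, unpunctured (p t)) -> a < t < b ->
    (forall s g, a <= s <= b -> s != t -> ~ on_line g (p s)) ->
    up_sign x.1 (p a) = up_sign x.1 (p t) -> crosses p t x ->
  step (p a) (p b) = [:: x].
Proof.
move=> pc pu atb noline upE xt; have /andP[a_t t_b] := atb; case: x upE xt => g c /= upE.
have hl u : a < u < t -> hfloor g (p a) = hfloor g (p u).
  move=> au; apply: hfloor_const => // [|s /andP[? ?]]; first lra.
  by apply: noline; [lra|apply/eqP; lra].
have hr u : t < u < b -> hfloor g (p b) = hfloor g (p u).
  move=> au; apply/esym/hfloor_const => // [|s /andP[? ?]]; first lra.
  by apply: noline; [lra|apply/eqP; lra].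
have others : on_line g (p t) -> step (p a) (p b) = step1 g (p a) (p b).
  move=> gt; apply: step_step1 => g' g'g; apply: hfloor_const => //; first lra.
  move=> s sab gs; have [st|st] := eqVneq s t; last exact: (noline s g').
  by rewrite st in gs; move: g'g; rewrite (unpunctured_on_line (pu t) gs gt) eqxx.
have step_lt u u' k : a < u < t -> t < u' < b -> hfloor g (p u) < k ->
    k <= hfloor g (p u') -> hfloor g (p a) < hfloor g (p b).
  by move=> au ub uk ku; rewrite (hl _ au) (hr _ ub); exact: lt_le_trans ku.
have step_gt u u' k : a < u < t -> t < u' < b -> k <= hfloor g (p u) ->
    hfloor g (p u') < k -> hfloor g (p b) < hfloor g (p a).
  by move=> au ub uk ku; rewrite (hl _ au) (hr _ ub); exact: lt_le_trans uk.
rewrite /crosses /=; case: eqP => [->|/eqP cE] [gt nr]; rewrite others //;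
  have [u [u' [ut u't [Qu _] [_ Qu']]]] := near_between atb nr;
  case: (gt) => k tk; rewrite tk in Qu Qu'; have /andP[_ /Qu hu] := ut;
  have /andP[/Qu' hu' _] := u't; rewrite /step1.
  by rewrite (step_lt u u' k) ?hfloor_lt ?hfloor_ge ?upE // ltW.
have lt : hfloor g (p b) < hfloor g (p a).
  by apply: (step_gt u u' k); rewrite ?hfloor_lt ?hfloor_ge // ltW.
by rewrite ltNge (ltW lt) lt upE; case: c (up_sign _ _) cE => -[].
Qed.

Lemma on_line_translate g z v : on_line g z -> on_line g (z + lat R v *+ 2).
Proof.
by case=> k zk; exists (k + lheight g v); rewrite height_translate zk -intrD mulrDr.
Qed.

(** A fine grid started just before time 0 and avoiding the crossing times has at most one crossing
    per cell, so its steps spell [w] letter by letter. The set [ts] to be avoided is returned so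
    that both boundary rows of a homotopy can share one grid. *)
Lemma row_word p v w (d e : R) :
    continuous p -> (forall t, unpunctured (p t)) ->
    (forall t, p (t + 1) = p t + lat R v *+ 2) ->
    0 < e -> (forall t, -1 <= t <= 1 -> separated (2 * d) (p t)) ->
    (forall t t', -1 <= t <= 1 -> -1 <= t' <= 1 -> `|t' - t| < e ->
       `|p t' - p t| < d / 4) ->
    reads p w ->
  exists (ts : seq R) (m : R), 0 < m /\ forall t0 n, - m < t0 < 0 ->
    n.+1%:R^-1 < m -> (forall j, (j <= n.+1)%N -> t0 + j%:R / n.+1%:R \notin ts) ->
    row (fun j => p (t0 + j%:R / n.+1%:R)) n.+1 = w.
Proof.
move=> pc pu pT e_gt0 sep unif [ts [sts mts szts cts]].
(* [m] is at most the modulus [e], at most 1 so that all samples lie in [-1, 1], at most the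
   distance from each crossing time to 1, and at most every gap between crossings. By periodicity no
   crossing occurs in ]-m, 0[. *)
have [m m_gt0 hm] := pos_lower_bound ([:: e; 1] ++ [seq 1 - x | x <- ts] ++
  [seq y - x | x <- ts, y <- ts]).
have me : m <= e by apply: hm => //; rewrite mem_head.
have m1 : m <= 1 by apply: hm => //; rewrite !in_cons eqxx orbT.
have mts1 x : x \in ts -> x <= 1 - m.
  move=> xts; have [/andP[x0 x1] _] := (mts x).1 xts; suff: m <= 1 - x by lra.
  by apply: hm; [rewrite !mem_cat (map_f (fun x => 1 - x) xts) !orbT|lra].
have gap x y : x \in ts -> y \in ts -> x < y -> x + m <= y.
  move=> xts yts xy; suff: m <= y - x by lra.
  by apply: hm; [rewrite !mem_cat (allpairs_f (fun x y => y - x) xts yts) !orbT|lra].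
have nocross t g : - m < t < 1 -> on_line g (p t) -> t \in ts.
  move=> tm gt; have [t_ge0|t_lt0] := leP 0 t.
    by apply/mts; split; [lra|exists g].
  have /mts1 : t + 1 \in ts; last lra.
  by apply/mts; split; [lra|exists g; rewrite pT; exact: on_line_translate].
exists ts, m; split => // t0 n t0m nm.
suff H (T : nat -> R) : (forall j, T j = t0 + j%:R / n.+1%:R) ->
    (forall j, (j <= n.+1)%N -> T j \notin ts) -> row (fun j => p (T j)) n.+1 = w.
  exact: H.
move=> TE gen.
have n_gt0 : 0 < n.+1%:R :> R by rewrite ltr0n.
have: 0 < n.+1%:R^-1 :> R by rewrite invr_gt0.
have: forall j, T j.+1 = T j + n.+1%:R^-1.
  move=> j.
  by rewrite !TE -addn1 natrD mulrDl mul1r addrA.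
move: n.+1%:R^-1 nm => h hm' TS h_gt0.
have T0 : T 0%N = t0 by rewrite TE mul0r addr0.
have Tn : T n.+1 = t0 + 1 by rewrite TE divff ?gt_eqF.
have T_le j : (j <= n.+1)%N -> t0 <= T j <= t0 + 1.
  move=> jn; rewrite TE lerDl lerD2l ler_pdivrMr // mul1r ler_nat jn andbT.
  by rewrite divr_ge0.
(* Invariant: the first j cells have read the prefix of [w] recorded before time [T j]. A cell
   either contains no crossing time or exactly the next one. *)
have K j : (j <= n.+1)%N ->
    row (fun j => p (T j)) j = take (count (fun x => x < T j) ts) w.
  elim: j => [_|j IHj jn].
    rewrite (eq_in_count (a2 := pred0)) ?count_pred0 ?take0 // => x /mts[/andP[x0 _] _] /=.
    by rewrite T0; apply/negbTE; rewrite -leNgt; lra.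
  have := T_le _ jn; have := T_le _ (ltnW jn); move=> Tj TSj; have TSj' := TS j.
  rewrite [LHS]/= IHj ?(ltnW jn) //.
  have [/hasP[t tts /andP[jt tj]]|/hasPn none] :=
      boolP (has (fun x => (T j < x) && (x < T j.+1)) ts); last first.
    rewrite (eq_in_count (a2 := fun x => x < T j.+1)) => [|x xts /=].
      suff hE g : hfloor g (p (T j)) = hfloor g (p (T j.+1)).
        by rewrite /step !step1_nil ?cats0.
      apply: hfloor_const => //; first lra.
      move=> t tj gt; have tts : t \in ts by apply: (nocross _ g) => //; lra.
      have ne i : (i <= n.+1)%N -> t != T i.
        by move=> /gen; apply: contraNneq => <-.
      have := none t tts; rewrite !lt_neqAle ne // eq_sym ne ?(ltnW jn) //=.
      by rewrite tj.
    have := none x xts; have [xj _|jx] := ltP x (T j); first by lra.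
    by rewrite lt_neqAle jx andbT; have [E|] := eqVneq (T j) x;
      [have := gen j (ltnW jn); rewrite E xts|move=> _ /= /negbTE ->].
  have [i [Di DSi ti iE]] : exists i, [/\ count (fun x => x < T j) ts = i,
      count (fun x => x < T j.+1) ts = i.+1, (i < size ts)%N & nth 0 ts i = t].
    move: sts gap; case/splitPr: tts => s1 s2 sts gap; exists (size s1).
    have mt : t \in s1 ++ t :: s2 by rewrite mem_cat mem_head orbT.
    move: sts; rewrite lt_sorted_pairwise pairwise_cat /= => /and3P[/allrelP lt1 _ /andP[/allP lt2 _]].
    have below x : x \in s1 -> x < T j.
      move=> xs; have xt : x < t by apply: lt1 => //; rewrite mem_head.
      have : x + m <= t by apply: gap => //; rewrite mem_cat xs.
      lra.
    have above x : x \in s2 -> T j.+1 <= x.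
      move=> xs; have xt : t < x by apply: lt2.
      have : t + m <= x by apply: gap => //; rewrite mem_cat in_cons xs !orbT.
      lra.
    have c1 y : T j <= y -> count (fun x => x < y) s1 = size s1.
      by move=> jy; apply/eqP; rewrite -all_count; apply/allP => x /below /= ?; lra.
    have c2 y : y <= T j.+1 -> count (fun x => x < y) s2 = 0%N.
      move=> yj; apply/eqP; rewrite eqn0Ngt -has_count; apply/hasPn => x /above /= ?.
      by rewrite -leNgt; lra.
    split.
    - by rewrite count_cat /= c1 // c2 1?ltNge 1?(ltW jt) ?addn0 //; lra.
    - by rewrite count_cat /= c1 ?c2 ?tj ?addn0 ?addn1 //; lra.
    - by rewrite size_cat /= addnS ltnS leq_addr.
    - by rewrite nth_cat ltnn subnn.
  have iw : (i < size w)%N by rewrite -szts.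
  have x0 : letter by exact: (Ga, true).
  rewrite Di DSi (take_nth x0) // -cats1; congr cat.
  have xt := cts i x0 iw; rewrite iE in xt.
  have [t_ge0 t_lt1] : 0 <= t /\ t < 1 by have [/andP[]] := (mts t).1 tts.
  have [k gt] : on_line (nth x0 w i).1 (p t).
    by move: xt; rewrite /crosses; case: ifP => _ [].
  apply: (@step_crosses p _ t) => //; first by rewrite jt.
    move=> s g sj st gs; have sts' : s \in ts by apply: (nocross _ g) => //; lra.
    have [lt|ge|E] := ltgtP s t; last by rewrite E eqxx in st.
      by have := gap _ _ sts' tts lt; lra.
    by have := gap _ _ tts sts' ge; lra.
  have jt_near : `|p (T j) - p t| < d / 4.
    by apply: unif; rewrite ?ltr_norml; lra.
  suff E : Num.floor (along (nth x0 w i).1 (p (T j))) =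
           Num.floor (along (nth x0 w i).1 (p t)) by rewrite /up_sign E.
  apply: (@floor_near _ _ _ d) => [n'|].
    apply: (@separated_along _ _ _ _ (2 * k)); first by apply: sep; lra.
    by rewrite gt subrr normr0; have := le_lt_trans (normr_ge0 _) jt_near; lra.
  rewrite -alongN -alongD; have := along_lt (nth x0 w i).1 jt_near.
  by have := le_lt_trans (normr_ge0 _) jt_near; lra.
rewrite K // (eq_in_count (a2 := predT)) ?count_predT ?szts ?take_size //.
by move=> x /mts1 /= ?; rewrite Tn; lra.
Qed.

End RowWord.

(** * Uniform bounds by compactness, and uniqueness of lifts up to Gamma *)

Section Homotopy.
Variable R : realType.
Implicit Types (z : R * R) (p q : R -> R * R) (P : R * R -> R * R).

Lemma separatedW (d d' : R) z : d <= d' -> separated d' z -> separated d z.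
Proof. by move=> dd' sz m; exact: le_trans dd' (sz m). Qed.

Lemma unpunctured_separated z : unpunctured z -> exists2 d : R, 0 < d & separated d z.
Proof.
move=> uz; pose frac (x : R) := x - (Num.floor x)%:~R.
have frac_bd x : 0 <= frac x < 1.
  by have := floor_itv x; rewrite /frac intrD => /andP[? ?]; lra.
have frac_far (x : R) (n : int) : Num.min (frac x) (1 - frac x) <= `|x - n%:~R|.
  have [nx|xn] := leP n (Num.floor x).
    rewrite ge_min; apply/orP; left; rewrite /frac.
    have : n%:~R <= (Num.floor x)%:~R :> R by rewrite ler_int.
    by have := floor_itv x; have := ler_norm (x - n%:~R); lra.
  rewrite ge_min; apply/orP; right; rewrite /frac.
  have : (Num.floor x + 1)%:~R <= n%:~R :> R by rewrite ler_int lezD1.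
  by have := ler_norm (n%:~R - x); rewrite distrC intrD; lra.
have norm1 (m : int * int) : `|z.1 - m.1%:~R| <= `|z - lat R m|.
  by rewrite prod_normE /= le_max lexx.
have norm2 (m : int * int) : `|z.2 - m.2%:~R| <= `|z - lat R m|.
  by rewrite prod_normE /= le_max lexx orbT.
have [f1|f1] := eqVneq (frac z.1) 0; last first.
  exists (Num.min (frac z.1) (1 - frac z.1)).
    by have /andP[f0 ?] := frac_bd z.1; rewrite lt_min lt_def f1 f0; lra.
  by move=> m; exact: le_trans (norm1 m).
have [f2|f2] := eqVneq (frac z.2) 0; last first.
  exists (Num.min (frac z.2) (1 - frac z.2)).
    by have /andP[f0 ?] := frac_bd z.2; rewrite lt_min lt_def f2 f0; lra.
  by move=> m; exact: le_trans (norm2 m).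
case: (uz (Num.floor z.1, Num.floor z.2)); move: f1 f2; rewrite /frac /lat /=.
by case: z {uz norm1 norm2} => x y /= ? ?; congr (_, _); lra.
Qed.

Lemma separated_near (d e : R) z z' : separated d z -> `|z' - z| < e ->
  separated (d - e) z'.
Proof.
move=> sz zz' m; have := sz m; have := ler_normD (z - z') (z' - lat R m).
by rewrite subrKA distrC in zz' *; lra.
Qed.

(** The bound sought is treated as a variable tending to 0 from the right, so that the near-covering
    form of compactness turns local bounds into a uniform one. *)
Lemma compact_separated P (K : set (R * R)) : continuous P ->
    (forall t, unpunctured (P t)) -> compact K ->
  exists2 d : R, 0 < d & forall t, K t -> separated (2 * d) (P t).
Proof.
move=> Pc Pu /compact_near_coveringP cK.
have H : \forall d \near (0 : R)^'+, K `<=` (fun t => separated (2 * d) (P t)).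
  apply: (cK _ _ (fun (d : R) t => separated (2 * d) (P t))) => t Kt.
  have [d d_gt0 sd] := unpunctured_separated (Pu t).
  have h1 : \forall s \near t, `|P t - P s| < d / 2.
    by move/cvgrPdist_lt : (Pc t); apply; rewrite divr_gt0.
  have h2 : \forall e \near (0 : R)^'+, e < d / 4.
    by apply: nbhs_right_lt; rewrite divr_gt0.
  near=> s e => /=; apply: (@separatedW _ (d - d / 2)).
    have ed : e < d / 4 by near: e; exact: h2.
 rewrite /=; lra.
  by apply: separated_near sd _; rewrite distrC; near: s; exact: h1.
have [d [d_gt0 hd]] : exists d : R, 0 < d /\ K `<=` (fun t => separated (2 * d) (P t)).
  apply: (@filter_ex _ (0 : R)^'+); apply: filterI => //; exact: nbhs_right_gt.
by exists d.
Unshelve. all: by end_near.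
Qed.

Lemma compact_uniform P (K : set (R * R)) (d : R) : continuous P -> 0 < d ->
    compact K ->
  exists2 e : R, 0 < e & forall t t', K t ->
    `|t'.1 - t.1| < e -> `|t'.2 - t.2| < e -> `|P t' - P t| < d.
Proof.
move=> Pc d_gt0 /compact_near_coveringP cK.
pose Q (e : R) t := forall t', `|t'.1 - t.1| < e -> `|t'.2 - t.2| < e -> `|P t' - P t| < d.
have H : \forall e \near (0 : R)^'+, K `<=` Q e.
  apply: (cK _ _ Q) => t Kt.
  have [r /= r_gt0 hr] : nbhs_ball_ (ball_ (fun x : R * R => `|x|)) t (fun s => `|P t - P s| < d / 2).
    by apply/nbhs_normP; move/cvgrPdist_lt : (Pc t); apply; rewrite divr_gt0.
  have r2 : r / 2 < r by rewrite gtr_pMr // invf_lt1 // ltr1n.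
  have h2 : \forall e \near (0 : R)^'+, e < r / 2.
    by apply: nbhs_right_lt; rewrite divr_gt0.
  have h1 : \forall s \near t, `|t - s| < r / 2.
    by apply/nbhs_normP; exists (r / 2) => //=; rewrite divr_gt0.
  near=> s e => /= t' t1 t2.
  have er : e < r / 2 by near: e; exact: h2.
  have ts : `|t - s| < r / 2 by near: s; exact: h1.
  have Ps : `|P t - P s| < d / 2 by apply: hr => /=; exact: lt_trans ts r2.
  have Pt' : `|P t - P t'| < d / 2.
    apply: hr => /=; rewrite -(subrKA s); apply: le_lt_trans (ler_normD _ _) _.
    have : `|s - t'| < r / 2; last by move=> st'; rewrite (splitr r) ltrD.
    by rewrite distrC prod_norm_lt /= (lt_trans t1) // (lt_trans t2).
  rewrite -(subrKA (P t)) (splitr d); apply: le_lt_trans (ler_normD _ _) _.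
  by rewrite ltrD // distrC.
have [e [e_gt0 he]] : exists e : R, 0 < e /\ K `<=` Q e.
  apply: (@filter_ex _ (0 : R)^'+); apply: filterI => //; exact: nbhs_right_gt.
by exists e => // t t' Kt; exact: he.
Unshelve. all: by end_near.
Qed.

Lemma lat_norm (v : int * int) : `|lat R v| < 1 -> v = 0.
Proof.
have K (n : int) : `|n%:~R : R| < 1%:~R -> n = 0 by rewrite -intr_norm ltr_int; lia.
by rewrite prod_norm_lt /= => /andP[/K m0 /K n0]; case: v m0 n0 => m n /= -> ->.
Qed.

Lemma latB (v v' : int * int) : lat R (v - v') = lat R v - lat R v'.
Proof. by rewrite /lat /= !intrB. Qed.

Lemma latN (v : int * int) : lat R (- v) = - lat R v.
Proof. by rewrite /lat /= !intrN. Qed.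

Lemma norm_mul2 z : `|z *+ 2| = 2 * `|z|.
Proof. by rewrite -scaler_nat prod_norm_scale ger0_norm. Qed.

Lemma eq_ler_norm z z' : z = z' -> `|z| <= `|z'|.
Proof. by move->. Qed.

(** The set of times where the same translation works is open, closed and contains 0. For openness:
    another translation differs by a vector of norm at least 2, and a reflection agrees nearly with
    a translation only near a lattice point, which [p t] avoids. *)
Lemma same_orbit_translation p q (v : int * int) :
    continuous p -> continuous q -> (forall t, unpunctured (p t)) ->
    (forall t, same_orbit (p t) (q t)) -> q 0 = p 0 + lat R v *+ 2 ->
  forall t, q t = p t + lat R v *+ 2.
Proof.
move=> pc qc pu pq q0; pose A := [set t | q t = p t + lat R v *+ 2].
have Aopen : open A.
  rewrite openE => t /= At.
  have [d d_gt0 sd] := unpunctured_separated (pu t).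
  pose e := Num.min d 1 / 4.
  have e_gt0 : 0 < e by rewrite divr_gt0 // lt_min d_gt0 ltr01.
  have e4 : e * 4 <= d /\ e * 4 <= 1 by rewrite /e divfK // !ge_min !lexx orbT.
  have hp : \forall s \near t, `|p t - p s| < e.
    by move/cvgrPdist_lt : (pc t); apply.
  have hq : \forall s \near t, `|q t - q s| < e.
    by move/cvgrPdist_lt : (qc t); apply.
  near=> s; rewrite /A /=.
  have ps : `|p t - p s| < e by near: s; exact: hp.
  have qs : `|q t - q s| < e by near: s; exact: hq.
  have [v' [E|E]] := pq s.
    suff vv' : v = v' by rewrite vv'.
    apply/eqP; rewrite -subr_eq0; apply/eqP/lat_norm; rewrite latB.
    have : `|(lat R v - lat R v') *+ 2| <= `|q t - q s| + `|p t - p s|.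
      apply: le_trans (ler_normB _ _); apply: (@eq_ler_norm _ _).
      by rewrite E At; apply: pair_ext => /=; rewrite ?mulr2n /=; lra.
    by rewrite norm_mul2; move: ps qs; lra.
  exfalso; have := sd (v' - v).
  have : `|(p t - lat R (v' - v)) *+ 2| <= `|q t - q s| + `|p t - p s|.
    apply: le_trans (ler_normD _ _); apply: (@eq_ler_norm _ _).
    by rewrite E At latB; apply: pair_ext => /=; rewrite ?mulr2n /=; lra.
  by rewrite norm_mul2; move: ps qs; lra.
have Aclosed : closed A.
  have -> : A = (fun t => q t - p t) @^-1` [set lat R v *+ 2].
    apply/seteqP; split => [t|t]; rewrite /A /=; first by move=> ->; rewrite addrC addKr.
    by move=> <-; rewrite addrC subrK.
  have /continuous_closedP : continuous (fun t => q t - p t).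
    by move=> t; apply: cvgB; [exact: qc|exact: pc].
  apply; apply: accessible_closed_set1; apply: hausdorff_accessible.
  exact: norm_hausdorff.
have AT : A = setT.
  have := @connected_intervalP R setT; case=> _; apply=> //.
  - by exists 0.
  - by exists A => //; rewrite setTI.
  - by exists A => //; rewrite setTI.
by move=> t; have : A t by rewrite AT.
Unshelve. all: by end_near.
Qed.

Lemma unpuncturedN z : unpunctured z -> unpunctured (- z).
Proof. by move=> uz m E; apply: (uz (- m)); rewrite latN -E opprK. Qed.

Lemma same_orbit_const p q :
    continuous p -> continuous q -> (forall t, unpunctured (p t)) ->
    (forall t, same_orbit (p t) (q t)) ->
  (exists v, forall t, q t = p t + lat R v *+ 2) \/
  (exists v, forall t, q t = - p t + lat R v *+ 2).
Proof.
move=> pc qc pu pq; have [v [q0|q0]] := pq 0; [left|right]; exists v.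
  exact: same_orbit_translation.
apply: (same_orbit_translation (p := fun t => - p t)) => //.
- by move=> t; apply: cvgN; exact: pc.
- by move=> t; apply: unpuncturedN.
- by move=> t; have [u [E|E]] := pq t; exists u; [right|left]; rewrite ?opprK.
Qed.

Lemma height_reflect g z (v : int * int) :
  height g (- z + lat R v *+ 2) = (2 * lheight g v)%:~R - height g z.
Proof. by rewrite height_translate heightN addrC. Qed.

Lemma on_line_reflect g z (v : int * int) :
  on_line g z -> on_line g (- z + lat R v *+ 2).
Proof.
by case=> k zk; exists (lheight g v - k); rewrite height_reflect zk -intrB mulrBr.
Qed.

Lemma along_not_int g z (n : int) :
  unpunctured z -> on_line g z -> along g z <> n%:~R.
Proof.
move=> uz [k zk] zn; apply: (uz (match g with Ga => (n, 2 * k) | Gb => (2 * k, n)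
  | Gc => (n, 2 * k - n) end)); move: zk zn; case: z uz => x y /= _.
by case: g => /= zk zn; rewrite /lat /= ?intrB -zk -zn; congr (_, _); lra.
Qed.

Lemma floor_opp (x : R) (n : int) : (forall m : int, x <> m%:~R) ->
  Num.floor (n%:~R - x) = n - Num.floor x - 1.
Proof.
move=> xn; apply: floor_def; have /andP[] := floor_itv x.
rewrite le_eqVlt => /orP[/eqP/esym/xn //|]; rewrite !(intrD, intrB) => ? ?.
by apply/andP; split; lra.
Qed.

Lemma dvd2_opp (n m : int) : (2 %| 2 * m - n - 1)%Z = ~~ (2 %| n)%Z.
Proof. lia. Qed.

(** For x not integral and n even, the floor of n - x is n - floor x - 1, of the opposite parity. *)
Lemma up_sign_reflect g z (v : int * int) : unpunctured z -> on_line g z ->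
  up_sign g (- z + lat R v *+ 2) = ~~ up_sign g z.
Proof.
move=> uz gz; rewrite /up_sign along_translate alongN addrC floor_opp.
  by rewrite dvd2_opp; case: g {gz}; rewrite ?negbK.
by move=> m; exact: along_not_int.
Qed.

Lemma reads_translate p q w (v : int * int) :
  (forall t, q t = p t + lat R v *+ 2) -> reads p w -> reads q w.
Proof.
move=> qE [ts [sts mts szts cts]].
have lineE g t : on_line g (q t) <-> on_line g (p t).
  split=> [|gt]; last by rewrite qE; exact: on_line_translate.
  move=> /(on_line_translate (- v)).
  by rewrite qE latN mulNrn addrK.
exists ts; split=> // [t|i x0 iw].
  by rewrite mts; split=> -[t01 [g]] /lineE gt; split => //; exists g.
have := cts i x0 iw; rewrite /crosses qE up_sign_translate.
by case: ifP => _ [/lineE gt nr]; split => //; apply: filterS nr => u [h1 h2];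
  rewrite !qE !height_translate !ltrD2r.
Qed.

Lemma reads_reflect p q w (v : int * int) : (forall t, unpunctured (p t)) ->
  (forall t, q t = - p t + lat R v *+ 2) -> reads p w -> reads q w.
Proof.
move=> pu qE [ts [sts mts szts cts]].
have lineE g t : on_line g (q t) <-> on_line g (p t).
  split=> [|gt]; last by rewrite qE; exact: on_line_reflect.
  move=> /(on_line_reflect v).
  by rewrite qE opprD opprK subrK.
exists ts; split=> // [t|i x0 iw].
  by rewrite mts; split=> -[t01 [g]] /lineE gt; split => //; exists g.
have xt := cts i x0 iw.
have gt : on_line (nth x0 w i).1 (p ts`_i).
  by move: xt; rewrite /crosses; case: ifP => _ [].
move: xt; rewrite /crosses qE up_sign_reflect //.
case: (nth x0 w i) gt => g b /= gt; case: b (up_sign _ _) => -[] /= [_ nr];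
  (split; first exact/lineE); apply: filterS nr => u [h1 h2];
  by rewrite !qE !height_reflect !ltrD2l !ltrN2; split.
Qed.

(** The retraction of the real line onto [0, 1]. Composing with it extends a homotopy to a map
    continuous on the whole plane, still avoiding the lattice. *)
Definition clamp (s : R) : R := (`|s| + 1 - `|s - 1|) / 2.

Lemma clamp_itv s : 0 <= clamp s <= 1.
Proof.
rewrite /clamp; have [h|h] := lerP 0 s;
  [rewrite (ger0_norm h)|rewrite (ltr0_norm h)];
  (have [h'|h'] := lerP 0 (s - 1);
   [rewrite (ger0_norm h')|rewrite (ltr0_norm h')]); lra.
Qed.

Lemma clamp_id s : 0 <= s <= 1 -> clamp s = s.
Proof. by move=> /andP[? ?]; rewrite /clamp ger0_norm // ler0_norm; lra. Qed.

Lemma continuous_clamp : continuous clamp.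
Proof.
move=> s; apply: cvgMl; apply: cvgB.
  by apply: cvgD; [exact: norm_continuous|exact: cvg_cst].
by apply: cvg_norm; apply: cvgB; [exact: cvg_id|exact: cvg_cst].
Qed.

Lemma continuous_clamped (H : R * R -> R * R) :
  {within `[0, 1] `*` [set: R], continuous H} ->
  continuous (fun x => H (clamp x.1, x.2)).
Proof.
move=> /subspace_continuousP Hc x.
have xA : (`[0, 1]%classic `*` [set: R]) (clamp x.1, x.2).
  by split => //=; rewrite in_itv /=; exact: clamp_itv.
move=> U /(Hc _ xA); rewrite /= !nbhs_simpl /within /= => h.
have cx : (fun y : R * R => (clamp y.1, y.2)) @ x --> (clamp x.1, x.2).
  apply: (@cvg_pair _ _ _ _ (nbhs (clamp x.1)) (nbhs x.2) _ _ _
    (fun y : R * R => clamp y.1) snd); last exact: cvg_snd.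
  by apply: cvg_comp; [exact: cvg_fst|exact: continuous_clamp].
have := cx _ h; rewrite /= nbhs_simpl /=; apply: filterS => y /=; apply.
by split => //=; rewrite in_itv /=; exact: clamp_itv.
Qed.

End Homotopy.

(** * From a curve to the straight line homotopic to it *)

Section LineHomotopy.
Variable R : realType.
Implicit Types (z : R * R) (p q : R -> R * R).

Lemma lineD1 z (v : int * int) (t : R) : line z v (t + 1) = line z v t + lat R v *+ 2.
Proof. by apply: pair_ext; rewrite /line /= mulr2n; ring. Qed.

Lemma line_translate z (u v : int * int) (t : R) :
  line (z + lat R u *+ 2) v t = line z v t + lat R u *+ 2.
Proof. by apply: pair_ext; rewrite /line /=; ring. Qed.

Lemma line_opp z (v : int * int) (t : R) : line (- z) (- v) t = - line z v t.
Proof. by apply: pair_ext; rewrite /line /= ?intrN; ring. Qed.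

Lemma continuous_line z (v : int * int) : continuous (line z v).
Proof.
move=> t; apply: (@cvg_pair _ _ _ _ (nbhs (line z v t).1) (nbhs (line z v t).2) _ _ _
  (fun t => z.1 + t * (2 * v.1%:~R)) (fun t => z.2 + t * (2 * v.2%:~R)));
  by apply: cvgD; [exact: cvg_cst|apply: cvgMl; exact: cvg_id].
Qed.

Lemma ex_natSinv_lt (m : R) : 0 < m -> exists n : nat, n.+1%:R^-1 < m.
Proof.
move=> m_gt0; exists (Num.bound m^-1); rewrite invf_plt ?posrE ?ltr0n //.
apply: lt_trans (archi_boundP _) _; first by rewrite invr_ge0 ltW.
by rewrite ltr_nat.
Qed.

Lemma homotopic_rows_conj (P : R * R -> R * R) (v : int * int) w w' :
    continuous P -> (forall x, unpunctured (P x)) ->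
    (forall s t, P (s, t + 1) = P (s, t) + lat R v *+ 2) ->
    reads (fun t => P (0, t)) w -> reads (fun t => P (1, t)) w' ->
  exists u, conj_by u w' w.
Proof.
move=> Pc Pu PT rw rw'.
have Prow s : continuous (fun t => P (s, t)).
  move=> t; apply: (@continuous_comp _ _ _ (fun t => (s, t)) P); last exact: Pc.
  by apply: (@cvg_pair _ _ _ _ (nbhs s) (nbhs t) _ _ _ (fun=> s) id);
    [exact: cvg_cst|exact: cvg_id].
pose K : set (R * R) := `[0, 1] `*` `[-1, 1].
have cK : compact K by apply: compact_setX; exact: segment_compact.
have inK s t : 0 <= s <= 1 -> -1 <= t <= 1 -> K (s, t).
  by move=> hs ht; split; rewrite /= in_itv.
have [d d_gt0 sep] := compact_separated Pc Pu cK.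
have [e e_gt0 unif] := compact_uniform Pc (divr_gt0 d_gt0 (ltr0n _ 4)) cK.
have row s w0 : 0 <= s <= 1 -> reads (fun t => P (s, t)) w0 ->
    exists (ts : seq R) (m : R), 0 < m /\ forall t0 n, - m < t0 < 0 ->
      n.+1%:R^-1 < m -> (forall j, (j <= n.+1)%N -> t0 + j%:R / n.+1%:R \notin ts) ->
      row (fun j => P (s, t0 + j%:R / n.+1%:R)) n.+1 = w0.
  move=> hs; apply: (row_word (v := v) (d := d) (e := e)) => //.
    by move=> t ht; apply: sep; exact: inK.
  move=> t t' ht ht' tt'; apply: (unif (s, t) (s, t')) => //.
  by rewrite /= subrr normr0.
have [|ts [m [m_gt0 hm]]] := row 0 w _ rw; first by rewrite lexx ler01.
have [|ts' [m' [m'_gt0 hm']]] := row 1 w' _ rw'; first by rewrite lexx ler01.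
have mm : 0 < Num.min e (Num.min m m') by rewrite !lt_min e_gt0 m_gt0.
have [n] := ex_natSinv_lt mm; rewrite !lt_min => /and3P[ne nm nm'].
(* The finitely many origins [t0] for which some grid time is a crossing time of one of the two
   boundary rows. *)
pose D := [seq x - j%:R / n.+1%:R | x <- ts ++ ts', j <- iota 0 n.+2].
pose m0 := Num.min 1 (Num.min m m').
have m0_gt0 : 0 < m0 by rewrite !lt_min ltr01 m_gt0.
have : - m0 < 0 by rewrite oppr_lt0.
have : m0 <= m0 by []; rewrite {2}/m0 !le_min => /and3P[m01 m0m m0m'].
case/(avoid_finite D) => t0 /andP[t0m t00] t0D.
have gen j : (j <= n.+1)%N -> t0 + j%:R / n.+1%:R \notin ts ++ ts'.
  move=> jn; apply: contra t0D => xts.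
  have ji : j \in iota 0 n.+2 by rewrite mem_iota.
  by have := allpairs_f (fun x (j : nat) => x - j%:R / n.+1%:R) xts ji; rewrite addrK.
have [|||u hu] := grid_conj PT (d := d) (e := e) _ _ _ ne (t0 := t0).
- by move=> s t hs ht; apply: sep; exact: inK.
- by move=> s t s' t' hs ht hs' ht' ss' tt'; apply: (unif (s, t)) => //; exact: inK.
- lra.
exists u; move: hu; rewrite mul0r divff ?pnatr_eq0 // hm' ?hm //; try lra.
  by move=> j /gen; rewrite mem_cat negb_or => /andP[].
by move=> j /gen; rewrite mem_cat negb_or => /andP[].
Qed.

Lemma homotopic_line_conj c z (v : int * int) w :
    closed_curve c -> freely_homotopic c (line z v) ->
    (forall t, unpunctured (line z v t)) -> reads c w ->
  exists z' v', [/\ v' = v \/ v' = - v, forall t, unpunctured (line z' v' t) &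
    forall w', reads (line z' v') w' -> exists u, conj_by u w' w].
Proof.
move=> [cc uc _] [H [Hc Hu HT H0 H1]] ul rw.
pose P x := H (clamp x.1, x.2).
have Pc : continuous P by exact: continuous_clamped.
have Pu x : unpunctured (P x) by apply: Hu; exact: clamp_itv.
have P0 t : P (0, t) = H (0, t) by rewrite /P /= clamp_id ?lexx ?ler01.
have P1 t : P (1, t) = H (1, t) by rewrite /P /= clamp_id ?lexx ?ler01.
have Prow s : continuous (fun t => P (s, t)).
  move=> t; apply: (@continuous_comp _ _ _ (fun t => (s, t)) P); last exact: Pc.
  by apply: (@cvg_pair _ _ _ _ (nbhs s) (nbhs t) _ _ _ (fun=> s) id);
    [exact: cvg_cst|exact: cvg_id].
have Pcol t : continuous (fun s => P (s, t)).
  move=> s; apply: (@continuous_comp _ _ _ (fun s => (s, t)) P); last exact: Pc.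
  by apply: (@cvg_pair _ _ _ _ (nbhs s) (nbhs t) _ _ _ id (fun=> t));
    [exact: cvg_id|exact: cvg_cst].
have same_sym x y : same_orbit x y -> same_orbit y x.
  move=> [u [->|->]]; [exists (- u); left|exists u; right].
    by rewrite latN mulNrn addrK.
  by rewrite opprD opprK subrK.
have r0 : reads (fun t => P (0, t)) w.
  have [|[u hu]|[u hu]] := same_orbit_const cc (Prow 0) uc.
  - by move=> t; apply: same_sym; rewrite P0.
  - exact: reads_translate hu rw.
  - exact: reads_reflect hu rw.
(* The end of the homotopy is the given line only up to one element of Gamma; a reflection turns the
   direction [v] into [- v]. *)
have [z' [v' [v'v line']]] : exists z' v',
    (v' = v \/ v' = - v) /\ forall t, P (1, t) = line z' v' t.
  have [|[u hu]|[u hu]] := same_orbit_const (@continuous_line z v) (Prow 1) ul.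
  - by move=> t; apply: same_sym; rewrite P1.
  - exists (z + lat R u *+ 2), v; split; first by left.
    by move=> t; rewrite line_translate hu.
  - exists (- z + lat R u *+ 2), (- v); split; first by right.
    by move=> t; rewrite line_translate line_opp hu.
exists z', v'; split => // [t|w' rw']; first by rewrite -line'.
apply: (homotopic_rows_conj (P := P) (v := v')) => //.
  (* For fixed [t], the element of Gamma taking [P (s, t)] to [P (s, t + 1)] does not depend on [s],
     so it can be read off at s = 1. There the line forces the translation by twice [v']: a
     reflection would put [P (1, t)] on the lattice. *)
  move=> s t; have [||[u hu]|[u hu]] := same_orbit_const (Pcol t) (Pcol (t + 1)).
  - by move=> s'; exact: Pu.
  - by move=> s'; rewrite /P /=; apply: HT; exact: clamp_itv.
  - rewrite hu; congr (_ + _); have := hu 1; rewrite !line' lineD1.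
    by move/addrI.
  - have := hu 1; rewrite !line' lineD1 => E; exfalso.
    apply: (Pu (1, t) (u - v')); rewrite line' latB; apply: pair_ext.
      have := congr1 fst E; rewrite /= !mulr2n /=; lra.
    have := congr1 snd E; rewrite /= !mulr2n /=; lra.
suff -> : (fun t => P (1, t)) = line z' v' by [].
by apply/funext.
Qed.

End LineHomotopy.

(** * The word of a straight line *)

Section LineWord.
Variable R : realType.
Variables (z0 : R * R) (v : int * int).
Hypothesis line_unpunctured : forall t, unpunctured (line z0 v t).
Hypothesis v_height : forall g, lheight g v != 0.
Implicit Types (z : R * R) (g : gen) (m : int * int).

Definition dsign g : int := sgz (lheight g v).
Definition dfloor g z : int := Num.floor ((dsign g)%:~R * height g z / 2).
(* Along the line, [index] increases by one at each crossing. *)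
Definition index z : int := dfloor Ga z + dfloor Gb z + dfloor Gc z.
Definition lindex m : int :=
  dsign Ga * lheight Ga m + dsign Gb * lheight Gb m + dsign Gc * lheight Gc m.

Lemma lheightD g m m' : lheight g (m + m') = lheight g m + lheight g m'.
Proof. by case: g => //=; rewrite addrACA. Qed.

Lemma lheightN g m : lheight g (- m) = - lheight g m.
Proof. by case: g => //=; rewrite opprD. Qed.

Lemma dsign_cases g : dsign g = 1 \/ dsign g = -1.
Proof. by rewrite /dsign; have := v_height g; case: sgzP => // _ _; [left|right]. Qed.

Lemma dsign_gt0 g : 0 < dsign g * lheight g v.
Proof. by rewrite /dsign; have := v_height g; case: sgzP => // h _; lia. Qed.

Lemma dfloor_translate g z m :
  dfloor g (z + lat R m *+ 2) = dfloor g z + dsign g * lheight g m.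
Proof.
rewrite /dfloor height_translate.
have -> : (dsign g)%:~R * (height g z + (2 * lheight g m)%:~R) / 2 =
  (dsign g)%:~R * height g z / 2 + (dsign g * lheight g m)%:~R.
  by rewrite !intrM; lra.
by rewrite floorDrz ?intr_int // intrKfloor.
Qed.

Lemma index_translate z m : index (z + lat R m *+ 2) = index z + lindex m.
Proof. by rewrite /index !dfloor_translate /lindex; ring. Qed.

Lemma dfloor_reflect g z m : unpunctured z ->
  dfloor g (- z + lat R m *+ 2) =
  dsign g * lheight g m - dfloor g z - (if `[< on_line g z >] then 0 else 1).
Proof.
move=> uz; rewrite dfloor_translate addrC -addrA; congr (_ + _).
rewrite /dfloor heightN.
have -> : (dsign g)%:~R * - height g z / 2 = 0%:~R - (dsign g)%:~R * height g z / 2.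
  by lra.
case: asboolP => [[k zk]|noline] /=.
  rewrite zk -[_ / 2](_ : (dsign g * k)%:~R = _) ?sub0r -?intrN ?intrKfloor ?subr0 //.
  by rewrite !intrM; lra.
rewrite floor_opp ?sub0r // => k zk; apply: noline.
by case: (dsign_cases g) zk => -> zk; [exists k|exists (- k)]; rewrite intrM ?intrN; lra.
Qed.

(** Negation turns the floor of a non-integer x into - floor x - 1. A crossing point lies on lines
    of exactly one type, so two of the three floors lose 1. *)
Lemma index_reflect g z m : unpunctured z -> on_line g z ->
  index (- z + lat R m *+ 2) = lindex m - index z - 2.
Proof.
move=> uz gz; rewrite /index !dfloor_reflect // /lindex.
have E g' : `[< on_line g' z >] = (g' == g).
  apply/asboolP/eqP => [g'z|-> //]; exact: unpunctured_on_line uz g'z gz.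
by rewrite !E; case: (g); rewrite /=; lia.
Qed.

(** Normalized so that it increases with [t] and the crossings of type [g] occur exactly at its
    integral values. *)
Definition val g (t : R) : R := (dsign g)%:~R * height g (line z0 v t) / 2.
Definition rate g : R := (dsign g * lheight g v)%:~R.

Lemma rate_gt0 g : 0 < rate g.
Proof. by rewrite ltr0z; exact: dsign_gt0. Qed.

Lemma height_line g t :
  height g (line z0 v t) = height g z0 + t * (2 * (lheight g v)%:~R).
Proof. by case: g => /=; rewrite ?intrD; ring. Qed.

Lemma valD g t s : val g (t + s) = val g t + s * rate g.
Proof. by rewrite /val /rate !height_line intrM; field. Qed.

Lemma val_lt g t s : t < s -> val g t < val g s.
Proof.
move=> ts; rewrite -(subrK t s) addrC valD ltrDl mulr_gt0 ?rate_gt0 //; lra.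
Qed.

Lemma val_on_line g t : on_line g (line z0 v t) <-> val g t = (Num.floor (val g t))%:~R.
Proof.
rewrite /val; split=> [[k ->]|].
  have -> : (dsign g)%:~R * (2 * k)%:~R / 2 = (dsign g * k)%:~R :> R.
    by rewrite !intrM; lra.
  by rewrite intrKfloor.
move: (Num.floor _) => k zk.
by case: (dsign_cases g) zk => -> zk; [exists k|exists (- k)]; rewrite intrM ?intrN; lra.
Qed.

Definition lineindex t : int := index (line z0 v t).

Lemma lineindexE t : lineindex t =
  Num.floor (val Ga t) + Num.floor (val Gb t) + Num.floor (val Gc t).
Proof. by []. Qed.

Lemma lineindex_le t s : t <= s -> lineindex t <= lineindex s.
Proof.
rewrite le_eqVlt => /orP[/eqP -> //|ts].
by rewrite !lineindexE !lerD // le_floor // ltW // val_lt.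
Qed.

Lemma lineindex_lt g t s : t < s -> on_line g (line z0 v s) ->
  lineindex t < lineindex s.
Proof.
move=> ts /val_on_line gs; have le g' := le_floor (ltW (val_lt g' ts)).
have lt : Num.floor (val g t) < Num.floor (val g s).
  by rewrite floor_lt_int -gs; exact: val_lt.
move: (le Ga) (le Gb) (le Gc); rewrite !lineindexE; case: (g) lt; lia.
Qed.

Lemma lineindex_inj g g' t s : on_line g (line z0 v t) -> on_line g' (line z0 v s) ->
  lineindex t = lineindex s -> t = s.
Proof.
move=> gt gs E; have [lt|lt|//] := ltgtP t s.
  by have := lineindex_lt lt gs; rewrite E ltxx.
by have := lineindex_lt lt gt; rewrite E ltxx.
Qed.

Lemma lineindex_period t : lineindex (t + 1) = lineindex t + lindex v.
Proof. by rewrite /lineindex lineD1 index_translate. Qed.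

(** The next crossing is of the type with the shortest waiting time [gap]. A second type reached at
    the same moment would place the line at a lattice point, so the index grows by exactly 1. *)
Lemma next_crossing t : exists s, [/\ t < s, exists g, on_line g (line z0 v s) &
  lineindex s = lineindex t + 1].
Proof.
pose gap g := ((Num.floor (val g t) + 1)%:~R - val g t) / rate g.
have gap_gt0 g : 0 < gap g.
  by rewrite divr_gt0 ?rate_gt0 // subr_gt0; have /andP[] := floor_itv (val g t).
have [g hg] : exists g, forall g', gap g <= gap g'.
  have [ab|/ltW ba] := leP (gap Ga) (gap Gb).
    have [ac|/ltW ca] := leP (gap Ga) (gap Gc); [exists Ga|exists Gc]; case => //.
    exact: le_trans ab.
  have [bc|/ltW cb] := leP (gap Gb) (gap Gc); [exists Gb|exists Gc]; case => //.
  exact: le_trans ba.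
have valg : val g (t + gap g) = (Num.floor (val g t) + 1)%:~R.
  by rewrite valD divfK ?gt_eqF ?rate_gt0 // addrC subrK.
have gs : on_line g (line z0 v (t + gap g)).
  by apply/val_on_line; rewrite valg intrKfloor.
have oth g' : g' != g -> Num.floor (val g' (t + gap g)) = Num.floor (val g' t).
  move=> g'g; apply: floor_def.
  have le : val g' (t + gap g) <= (Num.floor (val g' t) + 1)%:~R.
    have := hg g'; rewrite {2}/gap ler_pdivlMr ?rate_gt0 // valD; lra.
  have ne : val g' (t + gap g) != (Num.floor (val g' t) + 1)%:~R.
    apply/eqP => E; move/eqP: g'g; apply; apply: unpunctured_on_line gs => //.
    by apply/val_on_line; rewrite E intrKfloor.
  have := floor_itv (val g' t); have tg : t < t + gap g by rewrite ltrDl.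
  move=> /andP[fl _]; rewrite (le_trans fl) ?ltW ?(val_lt g' tg) //=.
  by rewrite lt_neqAle ne le.
exists (t + gap g); split; [by rewrite ltrDl|by exists g|].
have E : Num.floor (val g (t + gap g)) = Num.floor (val g t) + 1.
  by rewrite valg intrKfloor.
rewrite !lineindexE; move: E oth; move: (t + gap g) => s; case: (g) => -> oth.
- by rewrite (oth Gb) // (oth Gc) //; ring.
- by rewrite (oth Ga) // (oth Gc) //; ring.
- by rewrite (oth Ga) // (oth Gb) //; ring.
Qed.

Lemma crossing_sequence : exists tau : nat -> R,
  [/\ 0 <= tau 0%N,
      forall k, exists g, on_line g (line z0 v (tau k)),
      forall k, lineindex (tau k) = lineindex (tau 0%N) + k%:Z,
      {homo tau : k k' / (k < k')%N >-> k < k'} &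
      forall g t, 0 <= t -> on_line g (line z0 v t) -> exists k, t = tau k].
Proof.
have [next hnext] := choice next_crossing.
have [t0 [t0_ge0 [g0 t0l] t0_first]] : exists t0, [/\ 0 <= t0,
    exists g, on_line g (line z0 v t0) &
    forall g t, 0 <= t -> on_line g (line z0 v t) -> t0 <= t].
  have [gt|no] := pselect (exists g, on_line g (line z0 v 0)); first by exists 0.
  have [n0 ln En] := hnext 0; exists (next 0); split=> // [|g t t_ge0 gt]; first exact: ltW.
  rewrite leNgt; apply/negP => tn; have [g' g'n] := ln.
  have t_gt0 : 0 < t.
    by rewrite lt_neqAle t_ge0 andbT; apply: contra_notN no => /eqP ->; exists g.
  by have := lineindex_lt tn g'n; rewrite En ltzD1 leNgt (lineindex_lt t_gt0 gt).
pose tau k := iter k next t0; exists tau.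
have tauS k : [/\ tau k < tau k.+1, exists g, on_line g (line z0 v (tau k.+1)) &
    lineindex (tau k.+1) = lineindex (tau k) + 1] by exact: hnext.
have line_tau k : exists g, on_line g (line z0 v (tau k)).
  by case: k => [|k]; [exists g0|case: (tauS k)].
have index_tau k : lineindex (tau k) = lineindex (tau 0%N) + k%:Z.
  elim: k => [|k IHk]; first by rewrite addr0.
  by have [_ _ ->] := tauS k; rewrite IHk -addrA -addn1 PoszD.
split=> // [|g t t_ge0 gt].
  by apply: homo_ltn => [x y z|k]; [exact: lt_trans|case: (tauS k)].
have le := lineindex_le (t0_first g t t_ge0 gt).
exists `|lineindex t - lineindex t0|%N; have [g' g'k] := line_tau `|lineindex t - lineindex t0|%N.
apply: (lineindex_inj gt g'k); rewrite index_tau -[tau 0%N]/t0 gez0_abs ?subr_ge0 //.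
by rewrite addrCA subrr addr0.
Qed.

(** All lines of one type are crossed in the same direction, so the recorded letter is a function of
    the position. It is stated for any point of the plane because it is applied to images of
    crossings under Gamma, which are usually off the line. *)
Definition line_letter z (x : letter) :=
  on_line x.1 z /\ x.2 = (up_sign x.1 z == (0 < dsign x.1)).

Lemma line_letter_translate z x m :
  line_letter z x -> line_letter (z + lat R m *+ 2) x.
Proof.
move=> [xz x2]; split; first exact: on_line_translate.
by rewrite up_sign_translate.
Qed.

(** The point is reflected while the direction of travel is kept, so the transverse orientation
    alone is reversed. This is where inverse copies come from. *)
Lemma line_letter_reflect z x m : unpunctured z ->
  line_letter z x -> line_letter (- z + lat R m *+ 2) (linv x).
Proof.
move=> uz [xz x2]; split; first exact: on_line_reflect.
by rewrite /= x2 up_sign_reflect //; case: (up_sign _ _) (0 < _) => -[].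
Qed.

Lemma line_letter_inj z x y : unpunctured z ->
  line_letter z x -> line_letter z y -> x = y.
Proof.
case: x y => [g b] [g' b'] uz [/= gz ->] [/= g'z ->].
by rewrite (unpunctured_on_line uz gz g'z).
Qed.

Lemma line_letter_crosses t x : line_letter (line z0 v t) x ->
  crosses (line z0 v) t x.
Proof.
case: x => g b [/= gt ->]; rewrite /crosses /=.
have mono u s : (u < s) = ((dsign g)%:~R * height g (line z0 v u) <
    (dsign g)%:~R * height g (line z0 v s)).
  have K u' s' : u' < s' -> (dsign g)%:~R * height g (line z0 v u') <
      (dsign g)%:~R * height g (line z0 v s').
    by move=> /(val_lt g); rewrite /val; lra.
  apply/idP/idP => [/K //|us]; rewrite ltNge le_eqVlt; apply/negP => /orP[/eqP E|/K su].
    by rewrite E ltxx in us.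
  by have := lt_trans us su; rewrite ltxx.
have up : dsign g = 1 -> crosses_up g (line z0 v) t.
  move=> E; split => //; apply: filterS (@filterT _ (nbhs t) _) => u _.
  by rewrite (mono u t) (mono t u) E !mul1r.
have down : dsign g = -1 -> crosses_down g (line z0 v) t.
  move=> E; split => //; apply: filterS (@filterT _ (nbhs t) _) => u _.
  by rewrite (mono u t) (mono t u) E !intrN !mulN1r !ltrN2.
by case: (dsign_cases g) (up_sign _ _) => E []; rewrite E /=; auto.
Qed.

Lemma hfloor_on_line g z : unpunctured z -> on_line g z ->
  hfloor Gc z = hfloor Ga z + hfloor Gb z + (if g is Gc then 1 else 0).
Proof.
move=> uz gz; have noline g' (k : int) : g' != g -> height g' z / 2 <> k%:~R.
  move=> g'g E; move/eqP: g'g; apply; apply: unpunctured_on_line uz _ gz.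
  by exists k; rewrite intrM; lra.
case: gz noline => k zk noline; rewrite /hfloor.
case: g zk noline => /= zk noline.
- have -> : (z.1 + z.2) / 2 = z.1 / 2 + k%:~R by rewrite zk intrM; lra.
  have -> : z.2 / 2 = k%:~R by rewrite zk intrM; lra.
  by rewrite floorDrz ?intr_int // intrKfloor addr0 addrC.
- have -> : (z.1 + z.2) / 2 = z.2 / 2 + k%:~R by rewrite zk intrM; lra.
  have -> : z.1 / 2 = k%:~R by rewrite zk intrM; lra.
  by rewrite floorDrz ?intr_int // intrKfloor addr0.
- have -> : (z.1 + z.2) / 2 = k%:~R by rewrite zk intrM; lra.
  have -> : z.2 / 2 = k%:~R - z.1 / 2 by move: zk; rewrite intrM; lra.
  by rewrite floor_opp ?intrKfloor; [lia|move=> n; exact: (noline Gb)].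
Qed.

Lemma dfloor_hfloor g z : ~ on_line g z ->
  dfloor g z = dsign g * hfloor g z - (if dsign g == 1 then 0 else 1).
Proof.
move=> noline; rewrite /dfloor /hfloor.
case: (dsign_cases g) => -> /=; first by rewrite !mul1r subr0.
have -> : (-1)%:~R * height g z / 2 = 0%:~R - height g z / 2 by rewrite intrN; lra.
rewrite floor_opp ?sub0r ?mulN1r // => n zn; apply: noline; exists n.
by rewrite intrM; lra.
Qed.

(** Between two consecutive crossings of one type, the strips of both other types would be
    unchanged. As [height Gc] is the sum of the two other heights, [hfloor_on_line] then fixes the
    third strip as well, contradicting the strict growth of [val]. *)
Lemma consecutive_gen_neq g g' t s : t < s -> lineindex s = lineindex t + 1 ->
  on_line g (line z0 v t) -> on_line g' (line z0 v s) -> g != g'.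
Proof.
move=> ts E gt gs; apply/eqP => gg'; rewrite -gg' in gs => {gg' g'}.
have lt : Num.floor (val g t) < Num.floor (val g s).
  by have /val_on_line gs' := gs; rewrite floor_lt_int -gs'; exact: val_lt.
have le g' := le_floor (ltW (val_lt g' ts)).
have oth g' : g' != g -> hfloor g' (line z0 v t) = hfloor g' (line z0 v s).
  move=> g'g; have : Num.floor (val g' t) = Num.floor (val g' s).
    move: (le Ga) (le Gb) (le Gc) lt E; rewrite !lineindexE.
    by case: (g) (g') g'g => -[] //=; lia.
  rewrite -![Num.floor (val _ _)]/(dfloor _ (line z0 v _)) !dfloor_hfloor.
  - by case: (dsign_cases g') => -> /=; lia.
  - by move=> h; rewrite (unpunctured_on_line (@line_unpunctured s) h gs) eqxx in g'g.
  - by move=> h; rewrite (unpunctured_on_line (@line_unpunctured t) h gt) eqxx in g'g.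
have E' : hfloor g (line z0 v t) = hfloor g (line z0 v s).
  have := hfloor_on_line (@line_unpunctured t) gt.
  have := hfloor_on_line (@line_unpunctured s) gs.
  case: (g) oth => oth.
  - by have := oth Gb isT; have := oth Gc isT; lia.
  - by have := oth Ga isT; have := oth Gc isT; lia.
  - by have := oth Ga isT; have := oth Gb isT; lia.
have heightE r : on_line g (line z0 v r) ->
    height g (line z0 v r) = (2 * hfloor g (line z0 v r))%:~R.
  move=> [k rk]; rewrite /hfloor rk.
  by rewrite [X in Num.floor X](_ : _ = k%:~R) ?intrKfloor // intrM; lra.
by have := val_lt g ts; rewrite /val !heightE // E' ltxx.
Qed.

(** Time 1 amounts to the translation by twice [v], which raises the index by [lindex v]; crossings
    are determined by their index, so this is the period of [L]. Neighbouring letters involve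
    different generators, hence nothing cancels. *)
Lemma line_word : exists (L : nat -> letter) (tau : nat -> R) (i0 : int) (n : nat),
  [/\ n%:Z = lindex v, forall k, L (k + n)%N = L k,
      reads (line z0 v) (mkseq L n),
      forall k, noncancel (L k) (L k.+1) &
      forall k, line_letter (line z0 v (tau k)) (L k) /\
        lineindex (tau k) = i0 + k%:Z].
Proof.
have [tau [tau0 tau_line tau_index tau_lt tau_all]] := crossing_sequence.
have [gt hgt] := choice tau_line.
pose L k := (gt k, up_sign (gt k) (line z0 v (tau k)) == (0 < dsign (gt k))).
have L_letter k : line_letter (line z0 v (tau k)) (L k).
  by split; [exact: hgt|].
have n_ge0 : 0 <= lindex v.
  by rewrite /lindex !addr_ge0 // ltW // dsign_gt0.
pose n := `|lindex v|%N; have nE : n%:Z = lindex v by rewrite gez0_abs.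
have tau_period k : tau (k + n)%N = tau k + 1.
  have l1 : on_line (gt k) (line z0 v (tau k + 1)).
    by rewrite lineD1; exact: on_line_translate.
  apply: lineindex_inj (hgt _) l1 _.
  by rewrite lineindex_period (tau_index (k + n)%N) (tau_index k) -nE PoszD addrA.
exists L, tau, (lineindex (tau 0%N)), n; split=> // [k||k].
- apply: line_letter_inj (L_letter _) _ => //; rewrite tau_period lineD1.
  exact: line_letter_translate.
- exists (mkseq tau n); split; rewrite ?size_mkseq //.
  + exact: homo_sorted tau_lt _ (iota_ltn_sorted 0 n).
  + move=> t; split=> [/mapP[k]|[/andP[t_ge0 t_lt1] [g gt']]].
      rewrite mem_iota /= => kn ->; split; last exact: tau_line.
      have k_ge0 : 0 <= tau k.
        by case: k {kn} => // k; apply: le_trans tau0 (ltW (tau_lt _ _ (ltn0Sn k))).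
      rewrite k_ge0 ltNge; apply/negP => k_ge1; have [g' g'k] := tau_line k.
      have l1 : on_line g' (line z0 v (tau k - 1)).
        have -> : line z0 v (tau k - 1) = line z0 v (tau k) + lat R (- v) *+ 2.
          by rewrite -[in RHS](subrK 1 (tau k)) lineD1 latN mulNrn addrK.
        exact: on_line_translate.
      have [|j Ej] := tau_all _ _ _ l1; first by rewrite subr_ge0.
      have := tau_index k; rewrite -(subrK 1 (tau k)) Ej lineindex_period (tau_index j) -nE.
      lia.
    have [k Ek] := tau_all _ _ t_ge0 gt'; apply/mapP; exists k => //.
    rewrite mem_iota /= add0n ltnNge; apply/negP => nk.
    have : tau n <= tau k by move: nk; rewrite leq_eqVlt => /orP[/eqP ->|/tau_lt/ltW].
    have := tau_period 0%N; rewrite add0n; lra.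
  + by move=> i x0 i_n; rewrite !nth_mkseq //; exact: line_letter_crosses.
- rewrite /noncancel; apply/eqP => E.
  have idx : lineindex (tau k.+1) = lineindex (tau k) + 1.
    by rewrite (tau_index k.+1) (tau_index k) -addn1 PoszD addrA.
  have := consecutive_gen_neq (tau_lt _ _ (ltnSn k)) idx (hgt k) (hgt k.+1).
  have E1 : gt k.+1 = gt k := congr1 fst E.
  by rewrite E1 eqxx.
Qed.

End LineWord.

(** * Repetitions along a straight line *)

Section Slide.
Variable R : realType.
Variables (z0 : R * R) (v : int * int).
Hypothesis line_unpunctured : forall t, unpunctured (line z0 v t).
Hypothesis v_height : forall g, lheight g v != 0.
Implicit Types (z : R * R) (g : gen) (m : int * int) (x : R).

Definition dir g : int * int :=
  match g with Ga => (1, 0) | Gb => (0, 1) | Gc => (1, -1) end.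

(* A point on a line of type [g] lies on the segment from [low_end] to
   [high_end] cut out on it by [Z^2]. *)
Definition low_end g z : int * int :=
  let f := Num.floor (along g z) in let k := hfloor g z in
  match g with Ga => (f, 2 * k) | Gb => (2 * k, f) | Gc => (f, 2 * k - f) end.

Definition high_end g z : int * int := low_end g z + dir g.

Definition seg g m x : R * R := (m.1%:~R + x * (dir g).1%:~R, m.2%:~R + x * (dir g).2%:~R).

Lemma height_seg g g' m x :
  height g' (seg g m x) = (lheight g' m)%:~R + x * (lheight g' (dir g))%:~R.
Proof. by case: g'; rewrite /= ?intrD; ring. Qed.

Lemma along_seg g m x : along g (seg g m x) = (lalong g m)%:~R + x.
Proof. by case: g; rewrite /= ?mulr1. Qed.

Lemma lheight_dir g : lheight g (dir g) = 0.
Proof. by case: g. Qed.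

Lemma lheight_low g z : lheight g (low_end g z) = 2 * hfloor g z.
Proof.
rewrite /low_end; move: (hfloor g z) (Num.floor _) => k f.
by case: g => //=; rewrite addrC subrK.
Qed.

Lemma lalong_low g z : lalong g (low_end g z) = Num.floor (along g z).
Proof. by rewrite /low_end; move: (hfloor g z) (Num.floor _) => k f; case: g. Qed.

Lemma on_line_hfloor g z : on_line g z -> height g z = (2 * hfloor g z)%:~R.
Proof.
move=> [k zk]; rewrite /hfloor zk.
by rewrite [X in Num.floor X](_ : _ = k%:~R) ?intrKfloor // intrM; lra.
Qed.

Lemma on_line_seg g z : unpunctured z -> on_line g z ->
  exists2 x, 0 < x < 1 & z = seg g (low_end g z) x.
Proof.
move=> uz gz; exists (along g z - (Num.floor (along g z))%:~R).
  have /andP[] := floor_itv (along g z); rewrite le_eqVlt intrD.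
  move=> /orP[/eqP/esym/along_not_int|? ?]; first by case.
  by apply/andP; split; lra.
have := on_line_hfloor gz; rewrite /seg /low_end; move: (hfloor g z) => k.
by case: g {gz} => /= zk; apply: pair_ext => /=; rewrite ?intrB -?zk ?intrN; ring.
Qed.

Lemma dsign_dir g g' : [\/ dsign v g' * lheight g' (dir g) = 0,
  dsign v g' * lheight g' (dir g) = 1 | dsign v g' * lheight g' (dir g) = -1].
Proof.
by case: (dsign_cases v_height g') => ->; case: g; case: g' => /=;
   rewrite ?mul1r ?mulN1r ?opprK ?oppr0;
   (by constructor 1) || (by constructor 2) || (by constructor 3).
Qed.

(** The value is (n + u c) / 2 with n an integer and c in {-1, 0, 1}; it meets no new integer while
    0 < u < 1. Geometrically, lines of other types meet a segment only at its ends. *)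
Lemma dfloor_seg g g' m x y : 0 < x < 1 -> 0 < y < 1 ->
  dfloor v g' (seg g m x) = dfloor v g' (seg g m y).
Proof.
move=> x01 y01; rewrite /dfloor !height_seg.
set n := dsign v g' * lheight g' m; set c := dsign v g' * lheight g' (dir g).
have E (u : R) : (dsign v g')%:~R * ((lheight g' m)%:~R + u * (lheight g' (dir g))%:~R) / 2
    = (n%:~R + u * c%:~R) / 2.
  by rewrite !intrM; field.
rewrite !E; have cE : [\/ c = 0, c = 1 | c = -1] by exact: dsign_dir.
have [q qE] : exists q, n = 2 * q \/ n = 2 * q + 1.
  by exists (n %/ 2)%Z; lia.
have [k kE] : exists k : int, forall u : R, 0 < u < 1 ->
    Num.floor ((n%:~R + u * c%:~R) / 2) = k.
  case: qE cE => -> [] ->; [exists q|exists q|exists (q - 1)|exists q|exists q|exists q];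
    by move=> u /andP[? ?]; apply: floor_def;
       rewrite ?(intrD, intrM, intrN, subrK) ?intrB ?intrM; apply/andP; split; lra.
by rewrite !kE.
Qed.

Lemma index_seg g m x y : 0 < x < 1 -> 0 < y < 1 ->
  index v (seg g m x) = index v (seg g m y).
Proof.
by move=> x01 y01; rewrite /index !(dfloor_seg _ _ _ x01 y01).
Qed.

Definition det2 (m : int * int) (z : R * R) : R := m.1%:~R * z.2 - m.2%:~R * z.1.
Definition ldet (m m' : int * int) : int := m.1 * m'.2 - m.2 * m'.1.

Lemma det2_line t : det2 v (line z0 v t) = det2 v z0.
Proof. by rewrite /det2 /line /=; ring. Qed.

Lemma det2_lat m m' : det2 m (lat R m') = (ldet m m')%:~R.
Proof. by rewrite /det2 /ldet intrB !intrM. Qed.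

Lemma on_line_det2 z : det2 v z = det2 v z0 -> exists t, z = line z0 v t.
Proof.
rewrite /det2 => E; have v1 : v.1%:~R != 0 :> R by rewrite intr_eq0; exact: (v_height Gb).
exists ((z.1 - z0.1) / (2 * v.1%:~R)); apply: pair_ext => /=.
  by field.
by apply: (mulfI v1); rewrite mulrDr; move/eqP: E; rewrite subr_eq => /eqP ->; field.
Qed.

Lemma det2_seg g m x : det2 v (seg g m x) =
  (ldet v m)%:~R + x * ((ldet v (m + dir g))%:~R - (ldet v m)%:~R).
Proof. by rewrite /det2 /seg /ldet /= !(intrB, intrD, intrM); ring. Qed.

(** If the ends of the segment through [z] are strictly on opposite sides of the line, the line
    crosses this open segment. Letter and index are constant on it, so the crossing inherits those
    of [z]. *)
Lemma slide z (l : letter) : unpunctured z -> line_letter v z l ->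
    ((ldet v (low_end l.1 z))%:~R - det2 v z0) *
    ((ldet v (high_end l.1 z))%:~R - det2 v z0) < 0 ->
  exists t, line_letter v (line z0 v t) l /\ lineindex z0 v t = index v z.
Proof.
move=> uz [lz l2]; case: l lz l2 => g b /= gz bE sep.
have [x x01 zE] := on_line_seg uz gz.
pose A := (ldet v (low_end g z))%:~R - det2 v z0.
pose B := (ldet v (high_end g z))%:~R - det2 v z0.
rewrite -/A -/B in sep.
have AB : B - A != 0.
  by rewrite subr_eq0; apply: contraTneq sep => ->; rewrite -leNgt -expr2 sqr_ge0.
(* The zero of the affine function going from [A] to [B] along the segment. *)
pose y := - A / (B - A).
have y01 : 0 < y < 1.
  rewrite /y; have [ab|ba] := ltP 0 (B - A).
    by rewrite divr_gt0 ?ltr_pdivrMr //=; nra.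
  have ba' : 0 < A - B by rewrite -opprB oppr_gt0 lt_neqAle AB.
  by rewrite -[B - A]opprB invrN mulrNN divr_gt0 ?ltr_pdivrMr //=; nra.
have [t tE] : exists t, seg g (low_end g z) y = line z0 v t.
  apply: on_line_det2; rewrite det2_seg.
  have -> : (ldet v (low_end g z + dir g))%:~R - (ldet v (low_end g z))%:~R = B - A.
    by rewrite /A /B /high_end; ring.
  by rewrite /y divfK // /A; ring.
exists t; rewrite /lineindex -tE; split; last by rewrite [in RHS]zE; exact: index_seg.
split; rewrite /=.
  exists (hfloor g z); rewrite height_seg lheight_dir lheight_low mulr0 addr0 //.
have alongE : Num.floor (along g (seg g (low_end g z) y)) = Num.floor (along g z).
  rewrite along_seg lalong_low floorDzr ?intr_int // intrKfloor.
  by rewrite [Num.floor y](@floor_def _ _ 0) ?addr0 // add0r; lra.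
by rewrite bE /up_sign alongE.
Qed.

Lemma low_end_translate g z m :
  low_end g (z + lat R m *+ 2) = low_end g z + (m + m).
Proof.
rewrite /low_end hfloor_translate along_translate floorDrz ?intr_int // intrKfloor.
move: (hfloor g z) (Num.floor _) => k f; case: m => a b.
by case: g; apply: pair_ext => /=; lia.
Qed.

Lemma low_end_reflect g z m : unpunctured z -> on_line g z ->
  low_end g (- z + lat R m *+ 2) = m + m - high_end g z.
Proof.
move=> uz gz; rewrite /high_end /low_end along_translate alongN addrC floor_opp; last first.
  by move=> n; exact: along_not_int.
have -> : hfloor g (- z + lat R m *+ 2) = lheight g m - hfloor g z.
  rewrite hfloor_translate addrC; congr (_ + _).
  rewrite [LHS]/hfloor heightN (on_line_hfloor gz) [X in Num.floor X](_ : _ = (- hfloor g z)%:~R) ?intrKfloor //.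
  by rewrite intrM intrN; field.
move: (hfloor g z) (Num.floor _) => k f; case: m => a b.
by case: g gz => _; apply: pair_ext => /=; lia.
Qed.

Lemma high_end_translate g z m :
  high_end g (z + lat R m *+ 2) = high_end g z + (m + m).
Proof. by rewrite /high_end low_end_translate addrAC. Qed.

Lemma high_end_reflect g z m : unpunctured z -> on_line g z ->
  high_end g (- z + lat R m *+ 2) = m + m - low_end g z.
Proof.
move=> uz gz; rewrite {1}/high_end low_end_reflect // /high_end.
by rewrite opprD addrA subrK.
Qed.

(** Each signed height of an end lies strictly between 2F - 1 and 2F + 3, where F is the
    corresponding [dfloor] of [z], and equals 2F for the type [g] itself. Summing, the difference
    lies strictly between -2 and 6. *)
Lemma lindex_end g z m : unpunctured z -> on_line g z ->
    m = low_end g z \/ m = high_end g z ->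
  -1 <= lindex v m - 2 * index v z <= 5.
Proof.
move=> uz gz mE.
have [x /andP[x0 x1] zE] := on_line_seg uz gz.
have [y y01 hE] : exists2 y : R, -1 < y < 1 & forall g',
    height g' z = (lheight g' m)%:~R + y * (lheight g' (dir g))%:~R.
  case: mE => ->; [exists x|exists (x - 1)]; try lra.
    by move=> g'; rewrite {1}zE height_seg.
  by move=> g'; rewrite {1}zE height_seg /high_end lheightD intrD; ring.
have dE g' : (dsign v g' * lheight g' m)%:~R = 2 * ((dsign v g')%:~R * height g' z / 2)
    - y * (dsign v g' * lheight g' (dir g))%:~R.
  by rewrite hE !intrM; field.
have cE g' : [\/ dsign v g' * lheight g' (dir g) = 0,
    dsign v g' * lheight g' (dir g) = 1 | dsign v g' * lheight g' (dir g) = -1].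
  exact: dsign_dir.
have fl g' : (dfloor v g' z)%:~R <= (dsign v g')%:~R * height g' z / 2 < (dfloor v g' z)%:~R + 1.
  by have := floor_itv ((dsign v g')%:~R * height g' z / 2); rewrite intrD.
have flg : (dsign v g)%:~R * height g z / 2 = (dfloor v g z)%:~R.
  rewrite /dfloor (on_line_hfloor gz) [X in Num.floor X](_ : _ = (dsign v g * hfloor g z)%:~R).
    by rewrite intrKfloor !intrM; field.
  by rewrite !intrM; field.
have cg : (dsign v g * lheight g (dir g))%:~R = 0 :> R by rewrite lheight_dir mulr0.
have bd g' : 2 * (dfloor v g' z)%:~R - 1 < ((dsign v g' * lheight g' m)%:~R : R) <
    2 * (dfloor v g' z)%:~R + 3.
  rewrite dE; have /andP[f1 f2] := fl g'; have /andP[y1 y2] := y01.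
  by case: (cE g') => ->; rewrite ?intrN; apply/andP; split; lra.
have bdg : (dsign v g * lheight g m)%:~R = 2 * (dfloor v g z)%:~R :> R.
  by rewrite dE flg cg mulr0 subr0.
suff : - 2 < ((lindex v m - 2 * index v z)%:~R : R) < 6.
  rewrite -[-2]/((-2)%:~R) -[6]/(6%:~R) !ltr_int; lia.
rewrite /lindex /index !(intrB, intrM _ 2, intrD).
move: (bd Ga) (bd Gb) (bd Gc) bdg; case: (g) => /andP[? ?] /andP[? ?] /andP[? ?] ?;
  apply/andP; split; lra.
Qed.

End Slide.

(** * Translated and reflected copies of a run of crossings *)

Section Copies.
Variable R : realType.
Variables (z0 : R * R) (v : int * int).
Hypothesis line_unpunctured : forall t, unpunctured (line z0 v t).
Hypothesis v_height : forall g, lheight g v != 0.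
Variables (f f' : int * int) (a b e : int) (l : nat).
Implicit Types (z : R * R) (g : gen) (m : int * int).

(* A lattice point [m] is above or below the line according to the sign of
   [side m - level]. *)
Definition side m : int := e * ldet v m.
Let level : R := e%:~R * det2 v z0.
Definition comb (i j : int) : int * int := (i * f.1 + j * f'.1, i * f.2 + j * f'.2).

Hypothesis e_sign : e = 1 \/ e = -1.
Hypothesis side_f : side f = - b.
Hypothesis side_f' : side f' = a.
Hypothesis a_gt0 : 0 < a.
Hypothesis b_bounds : 0 <= b <= a.
Hypothesis comb_span : forall m, exists i j, m = comb i j.
Hypothesis lindex_f : lindex v f = (2 * l)%N%:Z.
Hypothesis lindex_f' : 0 <= lindex v f' <= (2 * l)%N%:Z.

Lemma sideD m m' : side (m + m') = side m + side m'.
Proof. by rewrite /side /ldet /=; ring. Qed.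

Lemma sideN m : side (- m) = - side m.
Proof. by rewrite /side /ldet /=; ring. Qed.

Lemma side_comb i j : side (comb i j) = - b * i + a * j.
Proof. by rewrite -side_f -side_f' /side /ldet /=; ring. Qed.

Lemma lindexD m m' : lindex v (m + m') = lindex v m + lindex v m'.
Proof. by rewrite /lindex !lheightD; ring. Qed.

Lemma lindexN m : lindex v (- m) = - lindex v m.
Proof. by rewrite /lindex !lheightN; ring. Qed.

Lemma lindex_comb i j : lindex v (comb i j) = (2 * l)%N%:Z * i + lindex v f' * j.
Proof. by rewrite -lindex_f /lindex /=; ring. Qed.

(* The best approximation property of convergents, in terms of [lindex]. *)
Lemma side_gap m : 0 < side m -> `|lindex v m| < (2 * l)%N%:Z -> a <= side m.
Proof.
have [i [j ->]] := comb_span m; rewrite side_comb lindex_comb.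
have /andP[f0 _] := lindex_f'; have /andP[b0 _] := b_bounds; move: a_gt0 => a0 s0.
rewrite ltr_norml => /andP[lo hi]; move: (2 * l)%N f0 lo hi => k f0 lo hi.
(* If j > 0 >= i, the side is at least a j. If i and j are positive, [lindex] reaches 2l; if j <= 0,
   a positive side forces i < 0 and [lindex] is at most -2l. *)
have [j_gt0|j_le0] := ltP 0 j.
  have [i_gt0|i_le0] := ltP 0 i; last by nia.
  by nia.
have i_lt0 : i < 0 by nia.
by nia.
Qed.

Lemma side_neq m : (side m)%:~R != level.
Proof.
apply/eqP; rewrite /level /side intrM => E.
have E' : det2 v (lat R m) = det2 v z0.
  by rewrite det2_lat; case: e_sign E => ->; rewrite ?intrN; lra.
have [t tE] := on_line_det2 v_height E'.
exact: (line_unpunctured (t := t)) (esym tE).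
Qed.

Lemma side_dir g : side (dir g) != 0.
Proof.
by have := v_height g; rewrite /side /ldet; case: e_sign => ->; case: g => /=; lia.
Qed.

Definition ends g z (up dn : int * int) :=
  (up = low_end g z /\ dn = high_end g z) \/ (up = high_end g z /\ dn = low_end g z).

Lemma line_ends g t : on_line g (line z0 v t) -> exists up dn,
  ends g (line z0 v t) up dn /\ (side dn)%:~R < level < (side up)%:~R.
Proof.
move=> gt; have [x /andP[x0 x1] zE] := on_line_seg (@line_unpunctured t) gt.
set p := low_end g _ in zE *; set q := high_end g (line z0 v t).
have levelE : level = (side p)%:~R + x * (side (dir g))%:~R.
  rewrite /level -(det2_line z0 v t) zE det2_seg /side /ldet /= !(intrM, intrB, intrD).
  by ring.
have qE : side q = side p + side (dir g) by rewrite -sideD.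
have [d_gt0|] := ltP 0 (side (dir g)).
  exists q, p; split; first by right.
  rewrite levelE qE intrD; have d0 : 0 < (side (dir g))%:~R :> R by rewrite ltr0z.
  by apply/andP; split; nra.
rewrite le_eqVlt (negPf (side_dir g)) /= => d_lt0.
exists p, q; split; first by left.
rewrite levelE qE intrD; have d0 : (side (dir g))%:~R < 0 :> R by rewrite ltrz0.
by apply/andP; split; nra.
Qed.

Lemma slide_ends z (x : letter) up dn : unpunctured z -> line_letter v z x ->
    ends x.1 z up dn ->
    (side dn)%:~R < level < (side up)%:~R \/ (side up)%:~R < level < (side dn)%:~R ->
  exists t, line_letter v (line z0 v t) x /\ lineindex z0 v t = index v z.
Proof.
move=> uz xz ud sep; apply: (slide v_height) => //.
pose F m := (ldet v m)%:~R - det2 v z0.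
have FE m : (side m)%:~R - level = e%:~R * F m.
  by rewrite /F /level /side intrM; ring.
have F2 : F up * F dn < 0.
  have -> : F up * F dn = ((side up)%:~R - level) * ((side dn)%:~R - level).
    by rewrite !FE; case: e_sign => ->; rewrite ?intrN; ring.
  by case: sep => /andP[s1 s2]; nra.
by case: ud => -[-> ->] in F2 *; rewrite // mulrC.
Qed.

Lemma argmin_nat (F : nat -> int) n : (0 < n)%N ->
  exists2 i, (i < n)%N & forall j, (j < n)%N -> F i <= F j.
Proof.
case: n => // n _; elim: n => [|n [i i_n iF]]; first by exists 0%N => // -[].
have [le|/ltW ge] := leP (F i) (F n.+1).
  exists i => [|j]; first exact: ltnW.
  by rewrite ltnS leq_eqVlt => /orP[/eqP ->|/iF].
exists n.+1 => // j; rewrite ltnS leq_eqVlt => /orP[/eqP -> //|/iF].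
exact: le_trans.
Qed.

Lemma bounded_steps (s : int -> int) (K : int) :
    (forall i, 1 <= s (i + 1) - s i <= K) ->
  forall T, exists i, T <= s i <= T + K.
Proof.
(* An index so negative that [s B < T], since [s] grows by at least 1 per step. The first later term
   reaching [T] overshoots by at most [K]. *)
move=> h T; pose B : int := - (`|s 0 - T|%N.+1)%:Z.
have sS i (k : nat) : 1 <= s (i + k.+1%:Z) - s (i + k%:Z) <= K.
  by have := h (i + k%:Z); rewrite (_ : i + k%:Z + 1 = i + k.+1%:Z) //; lia.
have sD i (k : nat) : s i + k%:Z <= s (i + k%:Z).
  elim: k => [|k]; first by rewrite !addr0.
  have := sS i k; move: (s (i + k.+1%:Z)) (s (i + k%:Z)) => x y; lia.
have lo : s B < T.
  have := sD B `|s 0 - T|.+1; rewrite addNr; move: (s B) (s 0) => x y; lia.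
have ex : exists k : nat, T <= s (B + k%:Z).
  exists (`|T - s B|)%N; have := sD B `|T - s B|%N.
  by move: (s (B + _)) => x; lia.
have := ex_minnP ex => -[k kT kmin].
case: k kT kmin => [|k] kT kmin; first by move: kT; rewrite addr0 leNgt lo.
exists (B + k.+1%:Z); rewrite kT.
have : ~~ (T <= s (B + k%:Z)).
  by apply/negP => /kmin; rewrite ltnn.
by have := sS B k; move: (s (B + k.+1%:Z)) (s (B + k%:Z)) => x y; lia.
Qed.

Lemma unpunctured_translate z m : unpunctured z -> unpunctured (z + lat R m *+ 2).
Proof.
by move=> uz p E; apply: (uz (p - (m + m))); rewrite latB -E /lat; apply: pair_ext;
  rewrite /= !intrD; ring.
Qed.

Lemma ends_translate g z m up dn : ends g z up dn ->
  ends g (z + lat R m *+ 2) (up + (m + m)) (dn + (m + m)).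
Proof.
by rewrite /ends low_end_translate high_end_translate => -[[-> ->]|[-> ->]]; auto.
Qed.

Lemma ends_reflect g z m up dn : unpunctured z -> on_line g z -> ends g z up dn ->
  ends g (- z + lat R m *+ 2) (m + m - up) (m + m - dn).
Proof.
move=> uz gz; rewrite /ends low_end_reflect // high_end_reflect //.
by move=> [[-> ->]|[-> ->]]; auto.
Qed.

Variables (L : nat -> letter) (tau : nat -> R) (i0 : int).
Hypothesis L_letter : forall k, line_letter v (line z0 v (tau k)) (L k).
Hypothesis tau_index : forall k, lineindex z0 v (tau k) = i0 + k%:Z.

Lemma letter_at k t x : line_letter v (line z0 v t) x ->
  lineindex z0 v t = i0 + k%:Z -> x = L k.
Proof.
move=> xt; rewrite -tau_index => E; have [gx _] := xt; have [gk _] := L_letter k.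
have tE := lineindex_inj v_height gx gk E.
by apply: line_letter_inj (L_letter k); rewrite -?tE //; exact: line_unpunctured.
Qed.

Section Run.
Variables (k1 n : nat).
Hypothesis n_gt0 : (0 < n)%N.
Hypothesis n_lt : (n + 5 <= l)%N.

(* The choice of [j] puts [side m1 + 2 side (comb i j)] within [a] of the level
   of the line: it then crosses either the translates by [2 comb i j] of the
   segments crossed during the run, or their reflections in [m1 + comb i j]. *)
Lemma run_copies : exists (j : int -> int) (o : int) (s : int -> int),
  [/\ `|o| <= n%:Z + 2, forall i, 0 <= j (i + 1) - j i <= 1,
      forall i, s i = i0 + k1%:Z + lindex v (comb i (j i)) \/
                s i = i0 + k1%:Z + lindex v (comb i (j i)) + o &
      forall i,
      (forall k, (k < n)%N -> exists t, line_letter v (line z0 v t) (L (k1 + k)) /\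
         lineindex z0 v t = s i + k%:Z) \/
      (forall k, (k < n)%N -> exists t,
         line_letter v (line z0 v t) (linv (L (k1 + (n - k.+1)))) /\
         lineindex z0 v t = s i + k%:Z)].
Proof.
have /choice[ud hud] k : exists p : (int * int) * (int * int),
    ends (L k).1 (line z0 v (tau k)) p.1 p.2 /\
    (side p.2)%:~R < level < (side p.1)%:~R.
  by have [up [dn h]] := line_ends (L_letter k).1; exists (up, dn).
have [k0 k0n k0min] := argmin_nat (fun k => side (ud (k1 + k)%N).1) n_gt0.
set m1 := (ud (k1 + k0)%N).1 in k0min.
have uk k : unpunctured (line z0 v (tau k)) by exact: line_unpunctured.
have end_bd k m : m = (ud k).1 \/ m = (ud k).2 ->
    -1 <= lindex v m - 2 * (i0 + k%:Z) <= 5.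
  move=> mE; rewrite -tau_index; apply: (lindex_end v_height (uk k) (L_letter k).1).
  by have [[[E1 E2]|[E1 E2]] _] := hud k; case: mE => ->; rewrite ?E1 ?E2; auto.
(* [m1] is the lowest upper end of the run. By [side_gap], all lower ends of the run are at least
   [a] below it, so one interval of displacements serves all the crossings at once. *)
have gap k : (k < n)%N -> side (ud (k1 + k)%N).2 + a <= side m1.
  move=> kn; have := @side_gap (m1 - (ud (k1 + k)%N).2).
  rewrite sideD sideN lindexD lindexN.
  have lt : side (ud (k1 + k)%N).2 < side m1.
    have [_ /andP[h1 _]] := hud (k1 + k)%N; have [_ /andP[_ h2]] := hud (k1 + k0)%N.
    by rewrite -(ltr_int R); exact: lt_trans h1 h2.
  have b1 := end_bd (k1 + k0)%N m1 (or_introl erefl).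
  have b2 := end_bd (k1 + k)%N _ (or_intror erefl).
  have h : `|lindex v m1 - lindex v (ud (k1 + k)%N).2| < (2 * l)%N%:Z.
    by move: (lindex v m1) (lindex v _) b1 b2 => x y; lia.
  by rewrite subr_gt0 => /(_ lt h); lia.
pose r : R := (side m1)%:~R - level.
have aR : 0 < a%:~R :> R by rewrite ltr0z.
(* Chosen so that subtracting its floor reduces the displacement [y] modulo 2a into [-a, a). Since
   b/a is in [0, 1], [q] falls by at most 1 per step and [j] rises by 0 or 1. *)
pose q (i : int) : R := (r - 2 * b%:~R * i%:~R + a%:~R) / (2 * a%:~R).
pose j i := - Num.floor (q i).
pose y i : R := r + 2 * (side (comb i (j i)))%:~R.
have yE i : y i = 2 * a%:~R * (q i - (Num.floor (q i))%:~R) - a%:~R.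
  rewrite /y side_comb /j /q !(intrD, intrM, intrN); field.
  by rewrite gt_eqF.
(* The end value -a would put the lattice point m1 + 2 comb + f' on the line, as [f'] has side [a];
   the value 0 is excluded below in the same way. *)
have y_bd i : - a%:~R < y i < a%:~R.
  have := side_neq (m1 + (comb i (j i) + comb i (j i)) + f').
  rewrite !sideD side_f' !intrD => ne.
  have yne : y i != - a%:~R.
    by apply: contra_neq ne; rewrite /y /r => ?; lra.
  have := floor_itv (q i); rewrite intrD => /andP[q0 q1].
  rewrite lt_neqAle eq_sym yne yE; nra.
have y_neq0 i : y i != 0.
  have := side_neq (m1 + (comb i (j i) + comb i (j i))).
  rewrite !sideD !intrD; apply: contra_neq; rewrite /y /r => ?; lra.
(* A reflection in m1 + comb sends index N to lindex m1 + lindex comb - N - 2 and reverses the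
   order. The reversed copy thus starts at the image of the last crossing, N = i0 + k1 + n - 1; [o]
   is its offset from the start of the translated copy. *)
pose o := lindex v m1 - 2 * (i0 + k1%:Z) - n%:Z - 1.
pose s i := i0 + k1%:Z + lindex v (comb i (j i)) + (if 0 < y i then 0 else o).
exists j, o, s; split.
- have := end_bd (k1 + k0)%N m1 (or_introl erefl).
  by rewrite /o PoszD; move: (lindex v m1) => x; lia.
- move=> i; rewrite /j; have /andP[b0 ba] := b_bounds.
  have b0R : 0 <= b%:~R :> R by rewrite ler0z.
  have baR : b%:~R <= a%:~R :> R by rewrite ler_int.
  pose u : R := b%:~R / a%:~R.
  have u01 : 0 <= u <= 1 by rewrite divr_ge0 ?(ltW aR) //= ler_pdivrMr // mul1r.
  have qS : q (i + 1) = q i - u.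
    by rewrite /q /u intrD; field; rewrite gt_eqF.
  have le1 : Num.floor (q (i + 1)) <= Num.floor (q i) by apply: le_floor; rewrite qS; lra.
  have le2 : Num.floor (q i) <= Num.floor (q (i + 1)) + 1.
    have -> : Num.floor (q (i + 1)) + 1 = Num.floor (q (i + 1) + 1%:~R).
      by rewrite floorDrz ?intr_int // intrKfloor.
    by apply: le_floor; rewrite qS; lra.
  by move: le1 le2; move: (Num.floor _) (Num.floor _) => x x'; lia.
- by move=> i; rewrite /s; case: ifP => _; [left; rewrite addr0|right].
move=> i; have /andP[y_lo y_hi] := y_bd i.
(* For 0 < y < a the translated upper ends remain above the line and the lower ones below. For -a <
   y < 0 the reflection exchanges their roles. *)
have [y_gt0|y_le0] := ltP 0 (y i); [left|right] => k kn.
  have [_ /andP[dn_lt up_gt]] := hud (k1 + k)%N; have [hends _] := hud (k1 + k)%N.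
  have uz := @unpunctured_translate _ (comb i (j i)) (uk (k1 + k)%N).
  have [|t [tl tE]] := slide_ends uz
    (line_letter_translate (comb i (j i)) (L_letter _)) (ends_translate _ hends).
    left; rewrite !sideD !intrD.
    have g1 : (side (ud (k1 + k)%N).2)%:~R + a%:~R <= (side m1)%:~R :> R.
      by rewrite -intrD ler_int; exact: gap.
    have g2 : (side m1)%:~R <= (side (ud (k1 + k)%N).1)%:~R :> R.
      by rewrite ler_int; exact: k0min.
    move: y_gt0 y_hi; rewrite /y /r => h1 h2.
    by apply/andP; split; lra.
  exists t; split => //; rewrite tE index_translate -/(lineindex z0 v _) tau_index.
  by rewrite /s y_gt0 PoszD; ring.
have y_lt0 : y i < 0 by rewrite lt_neqAle y_neq0.
set K := (k1 + (n - k.+1))%N.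
have Kn : (n - k.+1 < n)%N by lia.
have [_ /andP[dn_lt up_gt]] := hud K; have [hends _] := hud K.
pose p := m1 + comb i (j i).
have uz : unpunctured (- line z0 v (tau K) + lat R p *+ 2).
  by apply: unpunctured_translate; apply: unpuncturedN; exact: uk.
have [|t [tl tE]] := slide_ends uz (line_letter_reflect p (uk K) (L_letter K))
  (ends_reflect p (uk K) (L_letter K).1 hends).
  right; rewrite !(sideD, sideN) !(intrD, intrN).
  have g1 : (side (ud K).2)%:~R + a%:~R <= (side m1)%:~R :> R.
    by rewrite -intrD ler_int; exact: gap.
  have g2 : (side m1)%:~R <= (side (ud K).1)%:~R :> R.
    by rewrite ler_int; exact: k0min.
  move: y_lt0 y_lo; rewrite /y /r => h1 h2.
  by apply/andP; split; lra.
exists t; split => //.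
rewrite tE (index_reflect v_height p (uk K) (L_letter K).1) -/(lineindex z0 v _) tau_index.
rewrite /s ltNge y_le0 /= /p lindexD /o /K PoszD.
by move: (lindex v m1) (lindex v _) => x x'; lia.
Qed.

(** From i to i + 1 the start of the copy moves by 2l, plus 0 or [lindex v f'] (at most 2l), plus or
    minus at most n + 2 < l when the kind of copy changes. The step is thus between 1 and 5l, and
    some start falls in any interval of length 5l. *)
Lemma copies T : exists S : nat, (T <= S <= T + 5 * l)%N /\
  ((forall k, (k < n)%N -> L (S + k) = L (k1 + k)) \/
   (forall k, (k < n)%N -> L (S + k) = linv (L (k1 + (n - k.+1))))).
Proof.
have [j [d [s [d_bd jS sE hs]]]] := run_copies.
have steps i : 1 <= s (i + 1) - s i <= (5 * l)%N%:Z.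
  have := jS i; have := sE i; have := sE (i + 1).
  rewrite !lindex_comb; have := lindex_f'; move: (lindex v f') => x x_bd.
  move: (s (i + 1)) (s i) (j (i + 1)) (j i) => s1 s0 j1 j0 h1 h0 j01.
  have : x * j1 - x * j0 = 0 \/ x * j1 - x * j0 = x.
    have [->|->] : j1 = j0 \/ j1 = j0 + 1 by lia.
      by left; ring.
    by right; ring.
  move: (x * j1) (x * j0) h1 h0 => u1 u0 h1 h0 u01.
  have : (2 * l)%N%:Z * (i + 1) = (2 * l)%N%:Z * i + (2 * l)%N%:Z by ring.
  move: (_ * (i + 1)) (_ * i) h1 h0 => w1 w0 h1 h0 w10.
  by case: h1 h0 u01 => h1 [] h0 []; lia.
have [i /andP[T_le le_T]] := bounded_steps steps (i0 + T%:Z).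
have [S SE] : exists S : nat, s i = i0 + S%:Z.
  by exists `|s i - i0|%N; lia.
exists S; split; first by lia.
case: (hs i) => h; [left|right] => k /h[t [tl tE]];
  by rewrite -(letter_at (k := (S + k)%N) tl) // tE SE PoszD addrA.
Qed.

End Run.

End Copies.

(** * Convergents *)

Section Convergents.
Implicit Types (ns t : seq int) (p q : int * int).

(* [cfv (0, 1) ns] is (denominator, numerator) of [cfrac ns]. *)
Definition cfv p ns : int * int := foldr (fun n q => (q.2, n * q.2 + q.1)) p ns.
Definition conv ns : int * int := cfv (0, 1) ns.

Definition pos_entries t := all (fun n : int => 1 <= n) t.

Lemma cfv_lin p ns : cfv p ns =
  (p.2 * (conv ns).1 + p.1 * (cfv (1, 0) ns).1, p.2 * (conv ns).2 + p.1 * (cfv (1, 0) ns).2).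
Proof.
rewrite /conv; elim: ns => [|n ns IH] /=; first by case: p => x y /=; congr (_, _); ring.
by rewrite IH /=; congr (_, _); ring.
Qed.

Lemma cfv_rcons ns n : cfv (1, 0) (rcons ns n) = conv ns.
Proof. by rewrite /cfv foldr_rcons /= mulr0. Qed.

Lemma conv_cat ns ns' : conv (ns ++ ns') = cfv (conv ns') ns.
Proof. exact: foldr_cat. Qed.

(** Each partial quotient acts by a matrix of determinant -1. *)
Lemma ldet_cfv p q ns : ldet (cfv p ns) (cfv q ns) = (-1) ^+ size ns * ldet p q.
Proof.
elim: ns => [|n ns IH] /=; first by rewrite mul1r.
have -> : (-1) ^+ (size ns).+1 * ldet p q = - ldet (cfv p ns) (cfv q ns).
  by rewrite IH exprS; ring.
by rewrite /ldet /=; ring.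
Qed.

Lemma conv_pos t : pos_entries t ->
  [/\ 0 <= (conv t).1 <= (conv t).2, (size t)%:Z <= (conv t).2,
      1 <= (conv t).2, (0 < size t)%N -> 1 <= (conv t).1 &
      (1 < size t)%N -> (conv t).1 < (conv t).2].
Proof.
elim: t => [|n t IH] //= /andP[n1 /IH[]]; rewrite /conv /=.
case: (cfv _ t) => d p /= /andP[d0 dp] sp p1 d1 dlt.
have np : p <= n * p by nia.
split => //; [lia| |lia|by move=> /d1; lia].
by case: t d1 sp {dlt IH} => [|m t] /= d1 sp; [lia|have := d1 isT; lia].
Qed.

Lemma conv_cfrac n t : pos_entries t ->
  cfrac (n :: t) = (conv (n :: t)).2%:~R / (conv (n :: t)).1%:~R.
Proof.
elim: t n => [|m t IH] n => [_|/andP[m1 pt]].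
  by rewrite /cfrac /= invr0 addr0 /conv /= mulr1 addr0 divr1.
rewrite -[cfrac _]/(n%:~R + (cfrac (m :: t))^-1) IH // invf_div.
have [_ _ p1 _ _] := @conv_pos (m :: t) (introT andP (conj m1 pt)).
have p0 : (conv (m :: t)).2%:~R != 0 :> rat by rewrite intr_eq0; lia.
rewrite -[conv (n :: _)]/((conv (m :: t)).2, n * (conv (m :: t)).2 + (conv (m :: t)).1).
case: (conv (m :: t)) p0 => d p /= p0.
by rewrite intrD intrM mulrDl mulfK.
Qed.

(** The slope of [conv (n :: t)], for positive entries, lies in [n, n + 1]. The heights change sign
    only at slopes 0, -1 and infinity, none interior to this interval, so all these convergents
    share the signs given here. *)
Definition csign (n : int) g : int :=
  match g with Ga => if 0 <= n then 1 else -1 | Gb => 1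
  | Gc => if -1 <= n then 1 else -1 end.

Lemma conv_sign n t g : pos_entries t -> 0 <= csign n g * lheight g (conv (n :: t)).
Proof.
move=> /conv_pos[]; rewrite /conv /=; case: (cfv _ t) => d p /= /andP[d0 dp] _ p1 _ _.
by case: g => /=; try case: ifP => h; nia.
Qed.

Lemma conv_sign_lt n t g : pos_entries t -> (1 < size t)%N ->
  0 < csign n g * lheight g (conv (n :: t)).
Proof.
move=> /conv_pos[]; rewrite /conv /=; case: (cfv _ t) => d p /= /andP[d0 dp] _ p1 d1 dlt t2.
have {}d1 := d1 (ltnW t2); have {}dlt := dlt t2.
by case: g => /=; try case: ifP => h; nia.
Qed.

(** The form [lindex] of a convergent direction depends only on the integer part [n]. Hence
    [lindex v f], computed with the signs of [v], is the length of the word of the earlier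
    convergent [f]. *)
Definition cindex (n : int) (p : int * int) : int :=
  csign n Ga * lheight Ga p + csign n Gb * lheight Gb p + csign n Gc * lheight Gc p.

(** The form is the sum of the absolute values of x, y and x + y, hence at least 2|x|; the
    denominator x is at least the number of entries of [t]. *)
Lemma conv_size n t : pos_entries t ->
  2 * (size t)%:Z <= cindex n (conv (n :: t)).
Proof.
move=> /conv_pos[]; rewrite /conv /cindex /=.
case: (cfv _ t) => d p /= /andP[d0 dp] sp p1 _ _.
by case: ifP => h; case: ifP => h'; nia.
Qed.

Lemma coprime_conv ns : coprimez (conv ns).1 (conv ns).2.
Proof.
apply/coprimezP; pose q := cfv (1, 0) ns; pose s : int := (-1) ^+ size ns.
have := ldet_cfv (0, 1) (1, 0) ns; rewrite -/q -/(conv ns) -/s /ldet /= => E.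
have ss : s * s = 1 by rewrite /s -expr2 sqrr_sign.
exists (- s * q.2, s * q.1) => /=.
have -> : - s * q.2 * (conv ns).1 + s * q.1 * (conv ns).2 =
  - s * ((conv ns).1 * q.2 - (conv ns).2 * q.1) by ring.
by rewrite E mul0r sub0r mulrN1 mulrNN.
Qed.

Lemma conv_unique v n t : coprimez v.1 v.2 -> pos_entries t ->
  dir_slope v = Some (cfrac (n :: t)) -> v = conv (n :: t) \/ v = - conv (n :: t).
Proof.
move=> cv pt; rewrite conv_cfrac // /dir_slope; case: eqP => // /eqP v1 [].
set c := conv (n :: t) => E.
have c1 : c.1 != 0.
  by have [_ _ p1 _ _] := conv_pos pt; rewrite (_ : c.1 = (conv t).2) //; lia.
have cc : coprimez c.1 c.2 := coprime_conv _.
have cross : v.2 * c.1 = c.2 * v.1.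
  apply/eqP; rewrite -(eqr_int rat) !intrM; move/eqP: E.
  by rewrite eqr_div ?intr_eq0.
have d1 : (v.1 %| c.1)%Z.
  by rewrite -(Gauss_dvdzr _ cv) cross dvdz_mull.
have d2 : (c.1 %| v.1)%Z.
  by rewrite -(Gauss_dvdzr _ cc) -cross dvdz_mull.
have := conj d1 d2; rewrite !dvdzE => -[d1' d2'].
have /eqP : `|v.1|%N == `|c.1|%N by rewrite eqn_dvd d1' d2'.
move=> absE; have [E1|E1] : v.1 = c.1 \/ v.1 = - c.1.
  by move: absE {E cross c1 cc d1 d2 d1' d2'}; move: v.1 c.1 => x y; lia.
  left; apply: pair_ext => //; apply: (mulIf c1); rewrite cross E1 //.
right; apply: pair_ext => //=; apply: (mulIf c1); rewrite cross E1.
by rewrite mulNr mulrN.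
Qed.

End Convergents.

(** * Copies inside simple words *)

Lemma dsign_conv n t g : pos_entries t -> (1 < size t)%N ->
  dsign (conv (n :: t)) g = csign n g /\ dsign (- conv (n :: t)) g = - csign n g.
Proof.
move=> pt t2; have := conv_sign_lt n g pt t2.
rewrite /dsign lheightN sgzN; move: (lheight g _) => h ch.
have [c|c] : csign n g = 1 \/ csign n g = -1.
  by case: g {ch} => /=; try case: ifP; auto.
- by rewrite c mul1r in ch *; rewrite gtr0_sgz.
- by rewrite c mulN1r oppr_gt0 in ch *; rewrite ltr0_sgz ?opprK.
Qed.

Lemma lindex_conv n t m : pos_entries t -> (1 < size t)%N ->
  lindex (conv (n :: t)) m = cindex n m /\ lindex (- conv (n :: t)) m = - cindex n m.
Proof.
move=> pt t2; have d g := dsign_conv n g pt t2; rewrite /lindex /cindex.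
by split; [rewrite !(d _).1|rewrite !(d _).2]; ring.
Qed.

Lemma mkseq_noncancel (L : nat -> letter) n : (forall k, L (k + n)%N = L k) ->
  (forall k, noncancel (L k) (L k.+1)) -> cycle noncancel (mkseq L n).
Proof.
case: n => // n Lp Ln; rewrite /mkseq /=.
rewrite [X in rcons _ X](_ : _ = L n.+1) -?map_rcons; last by rewrite -(Lp 0%N).
have -> : rcons (iota 1 n) n.+1 = iota 1 n.+1.
  by have := iotaD 1 n 1; rewrite addn1 cats1 add1n.
suff P k i : path noncancel (L i) (map L (iota i.+1 k)) by exact: P.
by elim: k i => //= k IH i; rewrite Ln IH.
Qed.

Lemma rot_mkseq (L : nat -> letter) n j : (forall k, L (k + n)%N = L k) -> (j <= n)%N ->
  rot j (mkseq L n) = map L (iota j n).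
Proof.
move=> Lp jn; rewrite /rot /mkseq -map_drop -map_take drop_iota take_iota.
rewrite add0n (minn_idPl jn) -[in RHS](subnK jn) iotaD map_cat; congr (_ ++ _).
rewrite subnKC // (_ : iota n j = map (addn n) (iota 0 j)) -?map_comp; last first.
  by rewrite -iotaDl addn0.
by apply: eq_map => k /=; rewrite addnC Lp.
Qed.

(** The word of the line is cyclically reduced and conjugate to [w], so [w] is a rotation of it,
    that is, a window of one period in the periodic sequence [L]. *)
Lemma simple_word_line (R : realType) (w : word) n t :
    pos_entries t -> (1 < size t)%N -> simple_word R w (Some (cfrac (n :: t))) ->
  exists (z : R * R) (v : int * int) (L : nat -> letter) (tau : nat -> R) (i0 : int) (N j : nat),
  [/\ v = conv (n :: t) \/ v = - conv (n :: t),
      (forall s, unpunctured (line z v s)) /\ (forall g, lheight g v != 0),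
      forall k, line_letter v (line z v (tau k)) (L k) /\
        lineindex z v (tau k) = i0 + k%:Z,
      N%:Z = lindex v v & w = map L (iota j N)].
Proof.
move=> pt t2 [cw [c [[cc _] [z [v0 [cv sv ul hom]]] rw]]].
have v0E := conv_unique cv pt sv.
have [z' [v [vE uv conjv]]] := homotopic_line_conj cc hom ul rw.
have {}vE : v = conv (n :: t) \/ v = - conv (n :: t).
  by case: vE v0E => -> [] ->; rewrite ?opprK; auto.
have hv g : lheight g v != 0.
  have := conv_sign_lt n g pt t2.
  by case: vE => ->; rewrite ?lheightN ?oppr_eq0; apply: contraTneq => ->; rewrite mulr0.
have [L [tau [i0 [N [NE Lp rL Ln Lt]]]]] := line_word uv hv.
have [u hu] := conjv _ rL.
have [j wE] := conj_by_rot (mkseq_noncancel Lp Ln) (cyclically_reduced_cycle cw) hu.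
exists z', v, L, tau, i0, N; rewrite -NE.
have [j' wE'] : exists j', w = rot j' (mkseq L N).
  by exists (N - j)%N; rewrite -[w](rotK j) -wE /rotr size_mkseq.
exists (minn j' N); split=> //.
by rewrite wE' rot_minn size_mkseq rot_mkseq // geq_minr.
Qed.

(** Cut [g] into windows of length [K] and each window into the part before a copy, the copy, and
    the part after. The boolean marks the copies. *)
Lemma tiling (g w : word) (K : nat) :
    (forall T, (T + K <= size g)%N -> exists S, [/\ (T <= S)%N, (S + size w <= T + K)%N &
       take (size w) (drop S g) = w \/ take (size w) (drop S g) = winv w]) ->
  forall q, (q * K <= size g)%N -> exists ds : seq (bool * word),
    [/\ flatten (map snd ds) = take (q * K) g,
        forall d, d \in ds -> d.1 -> d.2 = w \/ d.2 = winv w &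
        (\sum_(d <- ds | d.1) size d.2 = q * size w)%N].
Proof.
move=> h; elim=> [|q IH] qK.
  by exists [::]; split; rewrite ?take0 ?big_nil.
have qK' : (q * K <= size g)%N by apply: leq_trans qK; rewrite leq_mul2r leqnSn orbT.
have [ds [dsE dsw dss]] := IH qK'.
have [|S [TS SK Sw]] := h (q * K)%N; first by rewrite addnC -mulSn.
pose A := take (S - q * K) (drop (q * K) g).
pose B := take (size w) (drop S g).
pose C := take (q * K + K - (S + size w)) (drop (S + size w) g).
exists (ds ++ [:: (false, A); (true, B); (false, C)]); split.
- have E : (q * K + K = S + size w + (q * K + K - (S + size w)))%N by rewrite subnKC.
  have ES : take S g = take (q * K) g ++ A by rewrite /A -takeD subnKC.
  rewrite map_cat flatten_cat dsE /= cats0 mulSn addnC [in RHS]E !takeD ES.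
  by rewrite /B /C -!catA.
- move=> d; rewrite mem_cat => /orP[/dsw //|].
  by rewrite !inE => /or3P[] /eqP ->.
- rewrite big_cat /= dss !big_cons big_nil /= addn0 mulSn addnC; congr (_ + _)%N.
  by case: Sw => E; rewrite /B E ?size_rev ?size_map.
Qed.

(** The prefix acts linearly on the vector of the tail; the columns of its matrix are the last two
    convergents of the prefix. So the coefficients a and b of the overview are the numerator and
    denominator of the tail. *)
Lemma conv_take ns i : (0 < i <= size ns)%N ->
  let f := conv (take i ns) in let f' := conv (take i.-1 ns) in
  let p := conv (drop i ns) in
  conv ns = (p.2 * f.1 + p.1 * f'.1, p.2 * f.2 + p.1 * f'.2) /\
  ldet f f' = (-1) ^+ i.+1.
Proof.
case: i => // i /= iz.
have fE : cfv (1, 0) (take i.+1 ns) = conv (take i ns).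
  by rewrite (take_nth 0) // cfv_rcons.
split; first by rewrite -{1}(cat_take_drop i.+1 ns) conv_cat cfv_lin fE.
rewrite -fE ldet_cfv size_take_min (minn_idPl iz) /ldet /=.
by rewrite !exprS; ring.
Qed.

Lemma cindex_take n t i : pos_entries t -> (i <= size t)%N ->
  0 <= cindex n (conv (n :: take i t)).
Proof.
move=> pt it; have pt' : pos_entries (take i t).
  by move: pt; rewrite -{1}(cat_take_drop i t) /pos_entries all_cat => /andP[].
by rewrite /cindex !addr_ge0 // conv_sign.
Qed.

Lemma cindex_take_le n t i : pos_entries t -> (0 < i < size t)%N ->
  cindex n (conv (n :: take i t)) <= cindex n (conv (n :: take i.+1 t)).
Proof.
case: i => // i pt /andP[_ it].
have := cindex_take n pt (ltnW (ltnW it)); have := cindex_take n pt (ltnW it).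
have n1 : 1 <= nth 0 t i.+1 by apply: (allP pt); exact: mem_nth.
have -> : conv (n :: take i.+2 t) =
    (nth 0 t i.+1 * (conv (n :: take i.+1 t)).1 + (conv (n :: take i t)).1,
     nth 0 t i.+1 * (conv (n :: take i.+1 t)).2 + (conv (n :: take i t)).2).
  rewrite (take_nth 0) // -cats1 -cat_cons conv_cat cfv_lin.
  rewrite [conv [:: _]]/conv /= mulr1 addr0 !mul1r.
  suff -> : cfv (1, 0) (take i.+1 t) = conv (take i t) by [].
  by rewrite (take_nth 0) ?(ltnW it) // cfv_rcons.
have cl m (u u' : int * int) :
    cindex n (m * u.1 + u'.1, m * u.2 + u'.2) = m * cindex n u + cindex n u'.
  by rewrite /cindex /=; ring.
rewrite cl; move: (cindex n _) (cindex n _) (nth 0 t _) n1 => x x' m m1 x0 x'0.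
nia.
Qed.

Lemma basis_copies (R : realType) (z : R * R) (v f f' : int * int) (a b e : int) (l : nat)
    (L : nat -> letter) (tau : nat -> R) (i0 : int) (k1 n T : nat) :
    (forall s, unpunctured (line z v s)) -> (forall g, lheight g v != 0) ->
    e = 1 \/ e = -1 -> ldet f f' = e ->
    v = (a * f.1 + b * f'.1, a * f.2 + b * f'.2) -> 0 < a -> 0 <= b <= a ->
    lindex v f = (2 * l)%N%:Z -> 0 <= lindex v f' <= (2 * l)%N%:Z ->
    (forall k, line_letter v (line z v (tau k)) (L k) /\
       lineindex z v (tau k) = i0 + k%:Z) ->
    (0 < n)%N -> (n + 5 <= l)%N ->
  exists S : nat, (T <= S <= T + 5 * l)%N /\
  ((forall k, (k < n)%N -> L (S + k)%N = L (k1 + k)%N) \/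
   (forall k, (k < n)%N -> L (S + k)%N = linv (L (k1 + (n - k.+1))%N))).
Proof.
move=> uv hv e1 ff' vE a0 ba lf lf' Lt n0 nl.
have ee : e * e = 1 by case: e1 => ->.
have sf : side v e f = - b.
  have -> : side v e f = - b * (e * ldet f f') by rewrite vE /side /ldet /=; ring.
  by rewrite ff' ee mulr1.
have sf' : side v e f' = a.
  have -> : side v e f' = a * (e * ldet f f') by rewrite vE /side /ldet /=; ring.
  by rewrite ff' ee mulr1.
have span m : exists i j, m = comb f f' i j.
  (* Cramer's rule; the determinant [e] is its own inverse. *)
  exists (e * ldet m f'), (e * ldet f m).
  apply: pair_ext; rewrite /comb /=.
    have -> : e * ldet m f' * f.1 + e * ldet f m * f'.1 = m.1 * (e * ldet f f').
      by rewrite /ldet; ring.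
    by rewrite ff' ee mulr1.
  have -> : e * ldet m f' * f.2 + e * ldet f m * f'.2 = m.2 * (e * ldet f f').
    by rewrite /ldet; ring.
  by rewrite ff' ee mulr1.
exact: (copies uv hv e1 sf sf' a0 ba span lf lf' (fun k => (Lt k).1) (fun k => (Lt k).2)).
Qed.

(** The word witnessing the special length is itself read along a line directed by the convergent or
    its opposite, so its length is the value of the linear form there. The shift from [i.+1] to [i]
    accounts for the entry [n]. *)
Lemma special_lengthE (R : realType) n t i l : pos_entries t -> (i <= size t)%N ->
  (1 < i)%N -> special_length R (n :: t) i.+1 l ->
  cindex n (conv (n :: take i t)) = (2 * l)%N%:Z.
Proof.
move=> pt it i1 [g [gw gl]].
have pt' : pos_entries (take i t).
  by move: pt; rewrite -{1}(cat_take_drop i t) /pos_entries all_cat => /andP[].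
have t2 : (1 < size (take i t))%N by rewrite size_takel.
have [z [v [L [tau [i0 [N [j [vE _ _ NE gE]]]]]]]] := simple_word_line pt' t2 gw.
have <- : N = (2 * l)%N.
  by move: gl; rewrite gE size_map size_iota -mul2n.
have [l1 l2] := lindex_conv n (conv (n :: take i t)) pt' t2.
rewrite NE; case: vE => ->; first by rewrite l1.
have [l3 l4] := lindex_conv n (- conv (n :: take i t)) pt' t2.
rewrite l4; move: (conv _) => c; rewrite /cindex !lheightN; ring.
Qed.

Lemma word_copies (R : realType) n t i l (g w : word) :
    pos_entries t -> (9 <= i <= size t)%N -> simple_word R g (Some (cfrac (n :: t))) ->
    special_length R (n :: t) i.+1 l -> subword w g -> (size w + 5 = l)%N ->
    (0 < size w)%N ->
  forall T, (T + 6 * l <= size g)%N -> exists S, [/\ (T <= S)%N, (S + size w <= T + 6 * l)%N &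
       take (size w) (drop S g) = w \/ take (size w) (drop S g) = winv w].
Proof.
move=> pt /andP[i9 it] gw hl [p [s' gE]] wl w0 T TN.
have lE := special_lengthE pt it (leq_trans (isT : 1 < 9)%N i9) hl.
have t2 : (1 < size t)%N by apply: leq_trans it; apply: leq_trans i9.
have [z [v [L [tau [i0 [N [j [vE [uv hv] Lt NE gL]]]]]]]] := simple_word_line pt t2 gw.
have [cE dE] := conv_take (ns := n :: t) (i := i.+1) (it : (0 < i.+1 <= size (n :: t))%N).
set f := conv (take i.+1 (n :: t)) in cE dE; set f' := conv (take i.+1.-1 (n :: t)) in cE dE.
set ab := conv (drop i.+1 (n :: t)) in cE.
have pd : pos_entries (drop i t).
  by move: pt; rewrite -{1}(cat_take_drop i t) /pos_entries all_cat => /andP[].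
have [ba _ a1 _ _] : [/\ 0 <= ab.1 <= ab.2, (size (drop i t))%:Z <= ab.2,
   1 <= ab.2, (0 < size (drop i t))%N -> 1 <= ab.1 &
   (1 < size (drop i t))%N -> ab.1 < ab.2] := conv_pos pd.
have a0 : 0 < ab.2 by apply: lt_le_trans a1.
have e1 : (-1) ^+ i.+2 = 1 :> int \/ (-1) ^+ i.+2 = -1 :> int.
  by rewrite -signr_odd; case: odd; [right|left].
have fE : f = conv (n :: take i t) by [].
have [i' iE] : exists i', i = i'.+1 by case: (i) i9 => // i' _; exists i'.
have f'E : f' = conv (n :: take i' t) by rewrite /f' iE.
have lf : cindex n f = (2 * l)%N%:Z by rewrite fE.
have lf' : 0 <= cindex n f' <= (2 * l)%N%:Z.
  rewrite -lE f'E iE cindex_take ?cindex_take_le //; rewrite iE in it i9.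
    by lia.
  by lia.
have copy T' : exists S : nat, (T' <= S <= T' + 5 * l)%N /\
  ((forall k, (k < size w)%N -> L (S + k)%N = L (j + size p + k)%N) \/
   (forall k, (k < size w)%N -> L (S + k)%N = linv (L (j + size p + (size w - k.+1))%N))).
  have wl' : (size w + 5 <= l)%N by rewrite wl.
  have li := lindex_conv n _ pt t2.
  (* When the line runs along the opposite of the convergent, [f] and [f'] are negated too; this
     keeps a, b, the determinant and the [lindex] values. *)
  case: vE => vE.
    apply: (basis_copies (f := f) (f' := f') (a := ab.2) (b := ab.1) (j + size p) T' uv hv e1) => //.
    - by rewrite vE cE.
    - by rewrite vE (li f).1.
    - by rewrite vE (li f').1.
  apply: (basis_copies (f := - f) (f' := - f') (a := ab.2) (b := ab.1) (j + size p) T' uv hv e1) => //.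
  - by rewrite -dE /ldet /=; ring.
  - by rewrite vE cE; apply: pair_ext => /=; ring.
  - by rewrite vE (li (- f)).2 -lf /cindex !lheightN; ring.
  - have -> : lindex v (- f') = cindex n f'.
      by rewrite vE (li (- f')).2 /cindex !lheightN; ring.
    by [].
have gN : size g = N by rewrite gL size_map size_iota.
have nthg k : (k < N)%N -> nth (Ga, true) g k = L (j + k)%N.
  by move=> kN; rewrite gL (nth_map 0%N) ?size_iota // nth_iota.
have nthw k : (k < size w)%N -> nth (Ga, true) w k = L (j + size p + k)%N.
  move=> kw; rewrite -addnA -nthg; last first.
    by rewrite -gN gE !size_cat ltn_add2l ltn_addr.
  by rewrite gE nth_cat ltnNge leq_addr /= addKn nth_cat kw.
(* Place T of [g] is place j + T of [L]. A start within 5l of it leaves room for the length l - 5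
   inside the window of length 6l. *)
have [S' [/andP[TS ST] hS]] := copy (j + T)%N.
pose S := (S' - j)%N; have SE : S' = (j + S)%N by rewrite subnKC //; apply: leq_trans TS; exact: leq_addr.
have SN : (S + size w <= T + 6 * l)%N by lia.
exists S; split => //; first by lia.
have szt : size (take (size w) (drop S g)) = size w.
  by rewrite size_takel // size_drop; lia.
case: hS => hS; [left|right]; apply: (@eq_from_nth _ (Ga, true)); rewrite szt ?size_rev ?size_map // => k kw;
  rewrite nth_take // nth_drop nthg; try lia; rewrite addnA -SE hS //.
  by rewrite nthw.
have lt : (size w - k.+1 < size w)%N by rewrite ltn_subrL w0.
by rewrite nth_rev ?size_map // (nth_map (Ga, true)) // nthw.
Qed.

Theorem theorem1p4 (R : realType) (gamma : word) (ns : seq int)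
    (hns : cf_expansion ns)
    (hgamma : simple_word R gamma (Some (cfrac ns)))
    (i l : nat) (hi : (10 <= i <= size ns)%N)
    (hl : special_length R ns i l)
    (hgl : (10 * l <= size gamma)%N)
    (w : word) (hw : subword w gamma) (hwl : (size w + 5 = l)%N) :
  exists (q : nat) (u : q.-tuple word) (I : {set 'I_q}),
    [/\ gamma = flatten u,
        forall k : 'I_q, k \in I -> tnth u k = w \/ tnth u k = winv w &
        ((size gamma)%:R / 30 <= (\sum_(k in I) size (tnth u k))%N%:R :> rat)%R].
Proof.
case: ns hns hgamma hi hl => [|n t] hns hgamma hi hl; first by move: hi => /=; lia.
case: i hi hl => [//|i] hi hl.
have i9 : (9 <= i <= size t)%N by move: hi; rewrite /= !ltnS.
have pt : pos_entries t.
  case: hns => _ h _; apply/(all_nthP 0) => k kt; exact: (h k.+1).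
have /andP[i9l it] := i9.
have lE := special_lengthE pt it (leq_trans (isT : 1 < 9)%N i9l) hl.
have pt' : pos_entries (take i t).
  by move: pt; rewrite -{1}(cat_take_drop i t) /pos_entries all_cat => /andP[].
(* The shifted [i] is at least 9, and 2i <= 2l by [conv_size]. *)
have l9 : (9 <= l)%N.
  have := conv_size n pt'; rewrite lE size_takel //; lia.
have w0 : (0 < size w)%N by lia.
have h := word_copies pt i9 hgamma hl hw hwl w0.
set q := (size gamma %/ (6 * l))%N.
have qK : (q * (6 * l) <= size gamma)%N by exact: leq_trunc_div.
have [ds [dsE dsw dss]] := tiling h qK.
(* The incomplete last window becomes one unmarked piece. *)
pose es := rcons ds (false, drop (q * (6 * l)) gamma).
exists (size es), (map_tuple snd (in_tuple es)), [set k | (tnth (in_tuple es) k).1]%SET.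
split.
- by rewrite /= /es map_rcons flatten_rcons dsE cat_take_drop.
- move=> k; rewrite inE tnth_map => k1.
  have := mem_tnth k (in_tuple es); rewrite /= /es mem_rcons inE => /orP[/eqP E|kds].
    by rewrite E in k1.
  exact: dsw.
- rewrite (eq_bigl (fun k => (tnth (in_tuple es) k).1)) => [|k]; last by rewrite inE.
  rewrite (eq_bigr (fun k => size (tnth (in_tuple es) k).2)) => [|k _]; last by rewrite tnth_map.
  rewrite -(big_tnth _ _ es (fun d : bool * word => d.1) (fun d : bool * word => size d.2)).
  rewrite /es -cats1 big_cat /= dss big_cons /= big_nil addn0.
  rewrite ler_pdivrMr // -natrM ler_nat.
  have qlt : (size gamma < q.+1 * (6 * l))%N by rewrite ltn_ceil // muln_gt0 /=; lia.
  have q1 : (1 <= q)%N by rewrite divn_gt0; lia.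
  (* As q >= 1, |gamma| < 6l(q + 1) <= 12ql, and 12l <= 30(l - 5) because l >= 9. *)
  by move: (size gamma) qlt {hgl qK dss dsw dsE h es} => N qlt; nia.
Qed.
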